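(* Let $R$ be a ring with identity and let $X$ be a chain complex of $R$-modules. Then $X$ is a Gorenstein AC-projective chain complex if and only if each $X_n$ is a Gorenstein AC-projective $R$-module and the complex of abelian groups $\mathit{Hom}(X,L)$ is exact for every level chain complex $L$. Equivalently, $X$ is Gorenstein AC-projective if and only if each $X_n$ is a Gorenstein AC-projective $R$-module and every chain map $f : X\to L$ is null homotopic whenever $L$ is a level chain complex.
   Context: $R$-modules are left $R$-modules unless stated otherwise; $\mathrm{Ch}(R)$ is the category of ($\mathbb{Z}$-graded, unbounded) chain complexes of left $R$-modules, with differentials lowering degree. A chain complex is finitely generated if it is bounded and finitely generated in each degree. Projective complexes are the projective objects of the category of chain complexes. For chain complexes $X,Y$, $\mathit{Hom}(X,Y)$ is the complex of abelian groups with $\mathit{Hom}(X,Y)_n = \prod_{k\in\mathbb{Z}} \mathrm{Hom}_R(X_k,Y_{k+n})$ and differential $(\delta_n f)_k = d_{k+n}f_k - (-1)^n f_{k-1}d_k$. A module (resp. chain complex) is of type $FP_\infty$ if it has a projective resolution by finitely generated projective modules (resp. finitely generated projective complexes). For a complex $X$ of right $R$-modules and a complex $Y$ of left $R$-modules, let $X\otimes Y$ be the usual tensor product of complexes. The modified tensor product $X\overline{\otimes}Y$ is the complex of abelian groups whose degree $n$ entry is $(X\otimes Y)_n/B_n(X\otimes Y)$, where $B_n$ denotes the boundaries, with differential $\overline{x\otimes y}\mapsto \overline{dx\otimes y}$. It is right exact in each variable, and its left derived functors are denoted $\overline{\mathrm{Tor}}_i$. A left $R$-module $N$ is level if $\mathrm{Tor}_1^R(M,N)=0$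 for all right $R$-modules $M$ of type $FP_\infty$. A chain complex $L$ of left $R$-modules is level if $\overline{\mathrm{Tor}}_1(X,L)=0$ for all chain complexes $X$ of right $R$-modules of type $FP_\infty$. An $R$-module $N$ is Gorenstein AC-projective if there is an exact complex of projective $R$-modules $\cdots\to P_1\to P_0\to P^0\to P^1\to\cdots$ with $N=\ker(P^0\to P^1)$ which remains exact after applying $\mathrm{Hom}_R(-,L)$ for every level $R$-module $L$. A chain complex $X$ is Gorenstein AC-projective if there is an exact complex of projective complexes $\cdots\to P_1\to P_0\to P^0\to P^1\to\cdots$ with $X=\ker(P^0\to P^1)$ which remains exact after applying $\mathrm{Hom}_{\mathrm{Ch}(R)}(-,L)$ (the abelian group of chain maps) for every level chain complex $L$. *)

(* Defs.v *)
From HB Require Import structures.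
From mathcomp Require Import all_boot all_order all_algebra.
From mathcomp Require Import boolp freeg.

Set Implicit Arguments.
Unset Strict Implicit.
Unset Printing Implicit Defensive.

Import GRing.Theory.
Local Open Scope ring_scope.
Local Open Scope quotient_scope.

(* A ring with identity is a [pzRingType], so that the zero ring is allowed.
   Left R-modules are [lmodType R]; right R-modules are [lmodType R^c], with
   R^c the opposite ring: the right action m.r is [(r : R^c) *: m].           *)

Section LinearMaps.
Variables (R : pzRingType) (U V : lmodType R).

Lemma linear_ext (f g : {linear U -> V}) : f =1 g -> f = g.
Proof.
case: f g => [f [[fD] [fZ]]] [g [[gD] [gZ]]] /= /funext fg; subst g.
by congr (GRing.Linear.Pack (GRing.Linear.Class _ _)); congr (_ _);
  exact: Prop_irrelevance.
Qed.

HB.instance Definition _ := gen_eqMixin {linear U -> V}.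
HB.instance Definition _ := gen_choiceMixin {linear U -> V}.

Let add (f g : {linear U -> V}) : {linear U -> V} := f \+ g.
Let opp (f : {linear U -> V}) : {linear U -> V} := \- f.
Let zero : {linear U -> V} := \0.

Fact linear_addA : associative add.
Proof. by move=> f g h; apply: linear_ext => x; exact: addrA. Qed.
Fact linear_addC : commutative add.
Proof. by move=> f g; apply: linear_ext => x; exact: addrC. Qed.
Fact linear_add0 : left_id zero add.
Proof. by move=> f; apply: linear_ext => x; exact: add0r. Qed.
Fact linear_addN : left_inverse zero opp add.
Proof. by move=> f; apply: linear_ext => x; exact: addNr. Qed.

HB.instance Definition _ := GRing.isZmodule.Build {linear U -> V}
  linear_addA linear_addC linear_add0 linear_addN.

End LinearMaps.

Definition dprod (I : Type) (V : I -> zmodType) := forall i, V i.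

Section Product.
Variables (I : Type) (V : I -> zmodType).

HB.instance Definition _ := gen_eqMixin (dprod V).
HB.instance Definition _ := gen_choiceMixin (dprod V).

Let add (f g : dprod V) : dprod V := fun i => f i + g i.
Let opp (f : dprod V) : dprod V := fun i => - f i.
Let zero : dprod V := fun=> 0.

Fact dprod_addA : associative add.
Proof. by move=> f g h; apply: functional_extensionality_dep => i; exact: addrA. Qed.
Fact dprod_addC : commutative add.
Proof. by move=> f g; apply: functional_extensionality_dep => i; exact: addrC. Qed.
Fact dprod_add0 : left_id zero add.
Proof. by move=> f; apply: functional_extensionality_dep => i; exact: add0r. Qed.
Fact dprod_addN : left_inverse zero opp add.
Proof. by move=> f; apply: functional_extensionality_dep => i; exact: addNr. Qed.

HB.instance Definition _ := GRing.isZmodule.Build (dprod V)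
  dprod_addA dprod_addC dprod_add0 dprod_addN.

End Product.

Section DirectSum.
Variables (I : eqType) (V : I -> zmodType).

Definition finsupp : {pred dprod V} :=
  fun f => `[< exists s : seq I, forall i, i \notin s -> f i = 0 >].

Fact finsupp_closed : zmod_closed finsupp.
Proof.
split; first by apply/asboolP; exists [::].
move=> f g /asboolP[s hs] /asboolP[t ht]; apply/asboolP; exists (s ++ t) => i.
rewrite mem_cat negb_or => /andP[/hs fi /ht gi].
by rewrite -[LHS]/(f i - g i) fi gi subr0.
Qed.
HB.instance Definition _ := GRing.isZmodClosed.Build (dprod V) finsupp finsupp_closed.

Record dsum := DSum { dsum_fun : dprod V; dsum_finsupp : dsum_fun \in finsupp }.
HB.instance Definition _ := [isSub for dsum_fun].
HB.instance Definition _ := [Choice of dsum by <:].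
HB.instance Definition _ := [SubChoice_isSubZmodule of dsum by <:].

Lemma dsum_ext (f g : dsum) : (forall i, dsum_fun f i = dsum_fun g i) -> f = g.
Proof. by move=> h; apply: val_inj; apply: functional_extensionality_dep. Qed.

End DirectSum.

Section DirectSumMap.
Variables (I J : eqType) (V : I -> zmodType) (W : J -> zmodType).
Variables (u : J -> I) (u_inj : injective u).
Variable phi : forall j, {additive V (u j) -> W j}.

Fact dsum_map_subproof (z : dsum V) :
  (fun j => phi j (dsum_fun z (u j))) \in @finsupp J W.
Proof.
case: z => z /= /asboolP[s hs]; apply/asboolP.
have [t ht] : exists t : seq J, forall j, u j \in s -> j \in t.
  elim: s {hs} => [|a s [t ht]]; first by exists [::].
  have [[k ak]|na] := pselect (exists k, u k = a); last first.
    exists t => j; rewrite inE => /predU1P[uj|/ht //].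
    by case: na; exists j.
  exists (k :: t) => j; rewrite !inE -{1}ak.
  by move=> /predU1P[/u_inj ->|/ht ->]; rewrite ?eqxx ?orbT.
exists t => j jt; rewrite hs ?raddf0 //.
by apply: contra jt => /ht.
Qed.

Definition dsum_map_fun (z : dsum V) : dsum W := DSum (dsum_map_subproof z).

Fact dsum_map_additive : zmod_morphism dsum_map_fun.
Proof. by move=> x y; apply: dsum_ext => j; exact: raddfB. Qed.

(* z |-> the family of the phi_j (z_(u j)) *)
Definition dsum_map : {additive dsum V -> dsum W} :=
  HB.pack dsum_map_fun
    (GRing.isZmodMorphism.Build _ _ dsum_map_fun dsum_map_additive).

End DirectSumMap.
Arguments dsum_map : simpl never.

Section Tensor.
Variables (R : pzRingType) (M : lmodType R^c) (N : lmodType R).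

Inductive tens_rel : {freeg (M * N)%type} -> Prop :=
| tens_rel0 : tens_rel 0
| tens_relB x y : tens_rel x -> tens_rel y -> tens_rel (x - y)
| tens_relDl m m' n :
    tens_rel (<< (m + m', n) >> - << (m, n) >> - << (m', n) >>)
| tens_relDr m n n' :
    tens_rel (<< (m, n + n') >> - << (m, n) >> - << (m, n') >>)
| tens_relZ (r : R) m n :
    tens_rel (<< ((r : R^c) *: m, n) >> - << (m, r *: n) >>).

Definition tens_sub : {pred {freeg (M * N)%type}} := fun x => `[< tens_rel x >].

Fact tens_sub_closed : zmod_closed tens_sub.
Proof.
split; first by apply/asboolP; exact: tens_rel0.
by move=> x y /asboolP hx /asboolP hy; apply/asboolP; exact: tens_relB.
Qed.
HB.instance Definition _ :=
  GRing.isZmodClosed.Build {freeg (M * N)%type} tens_sub tens_sub_closed.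

Definition tens : zmodType := Quotient.quot tens_sub.

Definition tpure (m : M) (n : N) : tens := \pi << (m, n) >>.

End Tensor.

Section QuotientLift.
Variables (A : zmodType) (I : zmodClosed A).

Lemma pi_quot_eq0 x : (\pi x == 0 :> Quotient.quot I) = (x \in I).
Proof. by rewrite -(raddf0 (\pi_(Quotient.quot I))) -Quotient.idealrBE subr0. Qed.

Lemma quot_ext (B : zmodType) (f g : {additive Quotient.quot I -> B}) :
  (forall x, f (\pi x) = g (\pi x)) -> f =1 g.
Proof. by move=> fg q; rewrite -[q]reprK. Qed.

Section Lift.
Variables (B : zmodType) (f : {additive A -> B}).
Hypothesis fI : forall x, x \in I -> f x = 0.

Definition quot_lift_fun (q : Quotient.quot I) : B := f (repr q).

Lemma quot_lift_pi x : quot_lift_fun (\pi x) = f x.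
Proof.
apply/eqP; rewrite -subr_eq0 -raddfB; apply/eqP/fI.
by rewrite Quotient.idealrBE reprK.
Qed.

Fact quot_lift_additive : zmod_morphism quot_lift_fun.
Proof.
move=> x y; rewrite -[x]reprK -[y]reprK -[_ - _](raddfB (\pi_(Quotient.quot I))).
by rewrite !quot_lift_pi raddfB.
Qed.

Definition quot_lift : {additive Quotient.quot I -> B} :=
  HB.pack quot_lift_fun
    (GRing.isZmodMorphism.Build _ _ quot_lift_fun quot_lift_additive).
End Lift.
End QuotientLift.
Arguments quot_lift : simpl never.

Section QuotientMap.
Variables (A B : zmodType) (I : zmodClosed A) (J : zmodClosed B).
Variable f : {additive A -> B}.
Hypothesis fIJ : forall x, x \in I -> f x \in J.

Fact quot_map_subproof x : x \in I -> (\pi_(Quotient.quot J) \o f) x = 0.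
Proof. by move=> /fIJ; rewrite -pi_quot_eq0 => /eqP. Qed.

Definition quot_map : {additive Quotient.quot I -> Quotient.quot J} :=
  quot_lift quot_map_subproof.

Lemma quot_map_pi x : quot_map (\pi x) = \pi_(Quotient.quot J) (f x).
Proof. exact: (quot_lift_pi quot_map_subproof). Qed.

End QuotientMap.
Arguments quot_map : simpl never.

Section FreeLift.
Variables (K : choiceType) (A : zmodType) (f : K -> A).

Definition free_lift_fun (x : {freeg K}) : A := fglift (f : K -> zmodule A) x.

Fact free_lift_additive : zmod_morphism free_lift_fun.
Proof. exact: (@lift_is_additive int K (zmodule A) f). Qed.

Definition free_lift : {additive {freeg K} -> A} :=
  HB.pack free_lift_fun
    (GRing.isZmodMorphism.Build _ _ free_lift_fun free_lift_additive).

Lemma free_liftU k : free_lift << k >> = f k.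
Proof. by rewrite /= /free_lift_fun liftU scale1r. Qed.

Lemma free_ext (g h : {additive {freeg K} -> A}) :
  (forall k, g << k >> = h << k >>) -> g =1 h.
Proof.
move=> gh x; rewrite -[x]freeg_sumE !raddf_sum; apply: eq_bigr => k _.
by rewrite -[coeff k x]intz -freegU_mulz !raddfMz gh.
Qed.
End FreeLift.
Arguments free_lift : simpl never.

Section TensorMap.
Variable R : pzRingType.

Lemma tpureDl (M : lmodType R^c) (N : lmodType R) m m' n :
  tpure (m + m') n = tpure m n + tpure m' n :> tens M N.
Proof.
apply/eqP; rewrite -subr_eq0 /tpure opprD addrA -!raddfB pi_quot_eq0.
by apply/asboolP; exact: tens_relDl.
Qed.

Lemma tpureDr (M : lmodType R^c) (N : lmodType R) m n n' :
  tpure m (n + n') = tpure m n + tpure m n' :> tens M N.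
Proof.
apply/eqP; rewrite -subr_eq0 /tpure opprD addrA -!raddfB pi_quot_eq0.
by apply/asboolP; exact: tens_relDr.
Qed.

Lemma tpureZ (M : lmodType R^c) (N : lmodType R) (r : R) m n :
  tpure ((r : R^c) *: m) n = tpure m (r *: n) :> tens M N.
Proof.
apply/eqP; rewrite -subr_eq0 /tpure -!raddfB pi_quot_eq0.
by apply/asboolP; exact: tens_relZ.
Qed.

Lemma tpure0l (M : lmodType R^c) (N : lmodType R) n : tpure 0 n = 0 :> tens M N.
Proof. by apply: (addrI (tpure 0 n)); rewrite -tpureDl !addr0. Qed.

Lemma tpure0r (M : lmodType R^c) (N : lmodType R) m : tpure m 0 = 0 :> tens M N.
Proof. by apply: (addrI (tpure m 0)); rewrite -tpureDr !addr0. Qed.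

Lemma tens_ext (M : lmodType R^c) (N : lmodType R) (A : zmodType)
    (f g : {additive tens M N -> A}) :
  (forall m n, f (tpure m n) = g (tpure m n)) -> f =1 g.
Proof.
move=> fg; apply: quot_ext => x.
by apply: (@free_ext _ _ (f \o \pi_(tens M N)) (g \o \pi_(tens M N))) => -[].
Qed.

Section Map.
Variables (M M' : lmodType R^c) (N N' : lmodType R).
Variables (f : {linear M -> M'}) (g : {linear N -> N'}).

Let h := free_lift (fun p : (M * N)%type => tpure (f p.1) (g p.2)).

Fact tmap_subproof x : x \in @tens_sub R M N -> h x = 0.
Proof.
move=> /asboolP; elim=> [|{}x y _ hx _ hy|m m' n|m n n'|r m n].
- exact: raddf0.
- by rewrite raddfB hx hy subr0.
- by rewrite !raddfB !free_liftU /= raddfD tpureDl [_ + tpure _ _]addrC addrK subrr.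
- by rewrite !raddfB !free_liftU /= raddfD tpureDr [_ + tpure _ _]addrC addrK subrr.
- by rewrite !raddfB !free_liftU /= !linearZ tpureZ subrr.
Qed.

Definition tmap : {additive tens M N -> tens M' N'} := quot_lift tmap_subproof.

Lemma tmap_pure m n : tmap (tpure m n) = tpure (f m) (g n).
Proof. by rewrite [LHS](quot_lift_pi tmap_subproof) free_liftU. Qed.
End Map.

Lemma tmap_comp (M M' M'' : lmodType R^c) (N N' N'' : lmodType R)
    (f : {linear M -> M'}) (f' : {linear M' -> M''})
    (g : {linear N -> N'}) (g' : {linear N' -> N''}) t :
  tmap f' g' (tmap f g t) = tmap (f' \o f) (g' \o g) t.
Proof.
apply: (tens_ext (f := tmap f' g' \o tmap f g)) => m n.
by rewrite -[LHS]/(tmap f' g' (tmap f g _)) !tmap_pure.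
Qed.

Lemma tmap0l (M M' : lmodType R^c) (N N' : lmodType R)
    (f : {linear M -> M'}) (g : {linear N -> N'}) t :
  (forall m, f m = 0) -> tmap f g t = 0.
Proof.
move=> f0; apply: (tens_ext (f := tmap f g) (g := \0)) => m n.
by rewrite [LHS]tmap_pure f0 tpure0l.
Qed.

Lemma tmap0r (M M' : lmodType R^c) (N N' : lmodType R)
    (f : {linear M -> M'}) (g : {linear N -> N'}) t :
  (forall n, g n = 0) -> tmap f g t = 0.
Proof.
move=> g0; apply: (tens_ext (f := tmap f g) (g := \0)) => m n.
by rewrite [LHS]tmap_pure g0 tpure0r.
Qed.

End TensorMap.
Arguments tmap : simpl never.

(* The differential lowers degree: [cd e] is the map X_i -> X_j for a proof e
   of i = j + 1.  Carrying e (proofs of integer equations are unique) avoids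
   transport along identities such as (i + 1) - 1 = i.                        *)

Record chcomplex (R : pzRingType) := ChComplex {
  cobj :> int -> lmodType R;
  cd : forall i j : int, i = j + 1 -> {linear cobj i -> cobj j};
  cd_cd : forall (i j k : int) (e : i = j + 1) (e' : j = k + 1) x, cd e' (cd e x) = 0 }.
Arguments cd {R} c [i j] e.

Record abcomplex := AbComplex {
  aobj :> int -> zmodType;
  ad : forall i j : int, i = j + 1 -> {additive aobj i -> aobj j};
  ad_ad : forall (i j k : int) (e : i = j + 1) (e' : j = k + 1) x, ad e' (ad e x) = 0 }.
Arguments ad a [i j] e : rename.

Record chmap (R : pzRingType) (X Y : chcomplex R) := ChMap {
  cmap :> forall n, {linear X n -> Y n};
  cmap_comm : forall (i j : int) (e : i = j + 1) x,
    cmap j (cd X e x) = cd Y e (cmap i x) }.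

Definition exact_at (A B C : zmodType) (f : A -> B) (g : B -> C) : Prop :=
  forall y, g y = 0 <-> exists x, f x = y.

Definition ab_exact (C : abcomplex) : Prop :=
  forall (i j k : int) (e : i = j + 1) (e' : j = k + 1), exact_at (ad C e) (ad C e').

Definition null_homotopic (R : pzRingType) (X Y : chcomplex R) (f : chmap X Y) :=
  exists s : forall i j : int, j = i + 1 -> {linear X i -> Y j},
    forall (i j k : int) (e : i = j + 1) (e' : j = k + 1) x,
      f j x = cd Y e (s j i e x) + s k j e' (cd X e' x).

Definition sgn (n : int) : int := (-1) ^ n.

Lemma sgnS n : sgn (n + 1) = - sgn n.
Proof. by rewrite /sgn exprzDr // expr1z mulrN1. Qed.

Lemma sgnP n : sgn n = 1 \/ sgn n = -1.
Proof.
rewrite /sgn; case: n => n; first by rewrite -exprnP -signr_odd; case: odd; auto.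
by rewrite NegzE -exprnN -signr_odd; case: odd; auto.
Qed.

Section SignMap.
Variables (A B : zmodType) (n : int) (f : {additive A -> B}).

Definition sgn_map_fun (x : A) : B := f x *~ sgn n.

Fact sgn_map_additive : zmod_morphism sgn_map_fun.
Proof. by move=> x y; rewrite /sgn_map_fun raddfB mulrzBl. Qed.

Definition sgn_map : {additive A -> B} :=
  HB.pack sgn_map_fun (GRing.isZmodMorphism.Build _ _ sgn_map_fun sgn_map_additive).

End SignMap.

Section HomComplex.
Variables (R : pzRingType) (X Y : chcomplex R).

(* Degree n is the product of the Hom_R(X_i, Y_j) over the pairs (i, j) with
   j = i + n.                                                                 *)
Definition hpairs (n : int) := {p : int * int | p.2 == p.1 + n}.

Definition hom_obj (n : int) : zmodType :=
  dprod (fun p : hpairs n => {linear X (val p).1 -> Y (val p).2} : zmodType).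

Fact hom_up_subproof (n m : int) (e : n = m + 1) (p : hpairs m) :
  (val p).2 + 1 == (val p).1 + n.
Proof. by rewrite e (eqP (valP p)) addrA. Qed.
Definition hom_up (n m : int) (e : n = m + 1) (p : hpairs m) : hpairs n :=
  exist _ ((val p).1, (val p).2 + 1) (hom_up_subproof e p).

Fact hom_dn_subproof (n m : int) (e : n = m + 1) (p : hpairs m) :
  (val p).2 == (val p).1 - 1 + n.
Proof. by rewrite e (eqP (valP p)) [m + 1]addrC addrA subrK. Qed.
Definition hom_dn (n m : int) (e : n = m + 1) (p : hpairs m) : hpairs n :=
  exist _ ((val p).1 - 1, (val p).2) (hom_dn_subproof e p).

Fact int_pred (i : int) : i = (i - 1) + 1. Proof. by rewrite subrK. Qed.

(* (delta_n f)_(i,j) = d f_(i,j+1) - (-1)^n f_(i-1,j) d *)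
Definition hom_d_fun (n m : int) (e : n = m + 1) (f : hom_obj n) : hom_obj m :=
  fun p => (cd Y (erefl _) \o f (hom_up e p) : {linear _ -> _})
           - (f (hom_dn e p) \o cd X (int_pred (val p).1) : {linear _ -> _})
             *~ sgn n.

Lemma linear_subE (U V : lmodType R) (f g : {linear U -> V}) x :
  (f - g) x = f x - g x.
Proof. by []. Qed.

Lemma linear_mulzE (U V : lmodType R) (f : {linear U -> V}) (z : int) x :
  (f *~ z) x = f x *~ z.
Proof.
have D (g h : {linear U -> V}) : (g + h) x = g x + h x by [].
have E n : (f *+ n) x = f x *+ n.
  by elim: n => // n IH; rewrite !mulrS D IH.
by case: z => n /=; rewrite ?NegzE ?mulrNz -!pmulrn ?E // -[LHS]/(- ((f *+ n.+1) x)) E.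
Qed.

Lemma hom_d_funE (n m : int) (e : n = m + 1) (f : hom_obj n) p x :
  hom_d_fun e f p x =
    cd Y (erefl _) (f (hom_up e p) x)
    - f (hom_dn e p) (cd X (int_pred (val p).1) x) *~ sgn n.
Proof. by rewrite /hom_d_fun linear_subE linear_mulzE. Qed.

Lemma hom_ext n (f g : hom_obj n) : (forall p, f p =1 g p) -> f = g.
Proof.
by move=> h; apply: functional_extensionality_dep => p; exact: linear_ext.
Qed.

Fact hom_d_additive (n m : int) (e : n = m + 1) : zmod_morphism (hom_d_fun e).
Proof.
have S k (f g : hom_obj k) p x : (f - g) p x = f p x - g p x by [].
move=> f g; apply: hom_ext => p x.
rewrite S !hom_d_funE (S _ f g (hom_up e p)) (S _ f g (hom_dn e p)).
by rewrite [cd Y _ (_ - _)]raddfB mulrzBl !opprD addrACA.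
Qed.

Definition hom_d (n m : int) (e : n = m + 1) : {additive hom_obj n -> hom_obj m} :=
  HB.pack (hom_d_fun e)
    (GRing.isZmodMorphism.Build _ _ (hom_d_fun e) (hom_d_additive e)).

Lemma hom_dE (n m : int) (e : n = m + 1) (f : hom_obj n) p x :
  hom_d e f p x =
    cd Y (erefl _) (f (hom_up e p) x)
    - f (hom_dn e p) (cd X (int_pred (val p).1) x) *~ sgn n.
Proof. exact: hom_d_funE. Qed.

Lemma hom_irr n (f : hom_obj n) i j (h h' : j == i + n) x :
  f (exist _ (i, j) h) x = f (exist _ (i, j) h') x.
Proof. by rewrite (bool_irrelevance h h'). Qed.

Fact hom_dd (n m l : int) (e : n = m + 1) (e' : m = l + 1) f :
  hom_d e' (hom_d e f) = 0.
Proof.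
apply: hom_ext => p x; rewrite !hom_dE.
rewrite [cd Y _ (_ - _)]linearB [cd Y _ (cd Y _ _)]cd_cd [cd X _ (cd X _ _)]cd_cd.
rewrite [f _ 0]linear0 mul0rz sub0r subr0.
rewrite [cd Y _ (_ *~ _)]raddfMz.
set z := cd X _ x.
have -> : f (hom_dn e (hom_up e' p)) z = f (hom_up e (hom_dn e' p)) z
  by exact: hom_irr.
have -> : sgn n = - sgn m by rewrite e sgnS.
by rewrite mulrNz opprK subrr.
Qed.

Definition homC : abcomplex := AbComplex hom_dd.

End HomComplex.
Arguments hom_d : simpl never.

Section TensorComplex.
Variables (R : pzRingType) (X : chcomplex R^c) (Y : chcomplex R).

(* Degree n is the direct sum of the X_i (x) Y_j over the pairs (i, j) with
   i + j = n.                                                                 *)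
Definition tpairs (n : int) := {p : int * int | p.1 + p.2 == n}.

Definition tens_obj (n : int) : zmodType :=
  dsum (fun p : tpairs n => tens (X (val p).1) (Y (val p).2)).

Fact tens_l_subproof (n m : int) (e : n = m + 1) (p : tpairs m) :
  ((val p).1 + 1) + (val p).2 == n.
Proof. by case: p => -[i j] /= /eqP h; rewrite e -h addrAC. Qed.
Definition tens_l (n m : int) (e : n = m + 1) (p : tpairs m) : tpairs n :=
  exist _ ((val p).1 + 1, (val p).2) (tens_l_subproof e p).

Fact tens_r_subproof (n m : int) (e : n = m + 1) (p : tpairs m) :
  (val p).1 + ((val p).2 + 1) == n.
Proof. by case: p => -[i j] /= /eqP h; rewrite e -h addrA. Qed.
Definition tens_r (n m : int) (e : n = m + 1) (p : tpairs m) : tpairs n :=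
  exist _ ((val p).1, (val p).2 + 1) (tens_r_subproof e p).

Lemma tens_l_inj (n m : int) (e : n = m + 1) : injective (tens_l e).
Proof.
move=> [[i j] h] [[i' j'] h'] /(congr1 val) /= [/addIr ii' jj'].
by apply: val_inj; rewrite /= ii' jj'.
Qed.

Lemma tens_r_inj (n m : int) (e : n = m + 1) : injective (tens_r e).
Proof.
move=> [[i j] h] [[i' j'] h'] /(congr1 val) /= [ii' /addIr jj'].
by apply: val_inj; rewrite /= ii' jj'.
Qed.

Definition tens_dl_map (n m : int) (e : n = m + 1) (p : tpairs m) :
    {additive tens (X (val (tens_l e p)).1) (Y (val (tens_l e p)).2)
              -> tens (X (val p).1) (Y (val p).2)} :=
  tmap (cd X (erefl _)) idfun.

Definition tens_dr_map (n m : int) (e : n = m + 1) (p : tpairs m) :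
    {additive tens (X (val (tens_r e p)).1) (Y (val (tens_r e p)).2)
              -> tens (X (val p).1) (Y (val p).2)} :=
  sgn_map (val p).1 (tmap idfun (cd Y (erefl _))).

(* x (x) y |-> dx (x) y *)
Definition tens_dl (n m : int) (e : n = m + 1) : {additive tens_obj n -> tens_obj m} :=
  dsum_map (@tens_l_inj n m e) (@tens_dl_map n m e).

(* x (x) y |-> (-1)^|x| x (x) dy *)
Definition tens_dr (n m : int) (e : n = m + 1) : {additive tens_obj n -> tens_obj m} :=
  dsum_map (@tens_r_inj n m e) (@tens_dr_map n m e).

Definition tens_d (n m : int) (e : n = m + 1) : {additive tens_obj n -> tens_obj m} :=
  tens_dl e \+ tens_dr e.

Lemma tens_dlE (n m : int) (e : n = m + 1) z p :
  dsum_fun (tens_dl e z) p = tmap (cd X (erefl _)) idfun (dsum_fun z (tens_l e p)).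
Proof. by []. Qed.

Lemma tens_drE (n m : int) (e : n = m + 1) z p :
  dsum_fun (tens_dr e z) p =
  tmap idfun (cd Y (erefl _)) (dsum_fun z (tens_r e p)) *~ sgn (val p).1.
Proof. by []. Qed.

Lemma tens_dE (n m : int) (e : n = m + 1) z : tens_d e z = tens_dl e z + tens_dr e z.
Proof. by []. Qed.

Lemma tens_irr n (z : tens_obj n) i j (h h' : i + j == n) :
  dsum_fun z (exist _ (i, j) h) = dsum_fun z (exist _ (i, j) h').
Proof. by rewrite (bool_irrelevance h h'). Qed.

Fact tens_dl_dl (n m l : int) (e : n = m + 1) (e' : m = l + 1) z :
  tens_dl e' (tens_dl e z) = 0.
Proof.
apply: dsum_ext => p; rewrite !tens_dlE tmap_comp.
by apply: tmap0l => x; exact: cd_cd.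
Qed.

Fact tens_dr_dr (n m l : int) (e : n = m + 1) (e' : m = l + 1) z :
  tens_dr e' (tens_dr e z) = 0.
Proof.
apply: dsum_ext => p; rewrite !tens_drE raddfMz tmap_comp tmap0r ?mul0rz //.
by move=> x; exact: cd_cd.
Qed.

Fact tens_dl_dr (n m m' l : int) (e : n = m + 1) (e' : m = l + 1)
    (f : n = m' + 1) (f' : m' = l + 1) z :
  tens_dl e' (tens_dr e z) = - tens_dr f' (tens_dl f z).
Proof.
apply: dsum_ext => -[[i j] h].
rewrite [RHS]/(- dsum_fun (tens_dr f' (tens_dl f z)) _) tens_dlE !tens_drE tens_dlE.
rewrite raddfMz !tmap_comp sgnS mulrNz; congr (- (_ *~ _)).
set x := dsum_fun z _; set y := dsum_fun z _.
have -> : x = y by exact: tens_irr.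
by apply: tens_ext => a b; rewrite !tmap_pure.
Qed.

Fact tens_dl_d (n m m' l : int) (e : n = m + 1) (e' : m = l + 1)
    (f : n = m' + 1) (f' : m' = l + 1) z :
  tens_dl e' (tens_d e z) = - tens_d f' (tens_dl f z).
Proof. by rewrite !tens_dE raddfD !tens_dl_dl !add0r (tens_dl_dr _ _ f f'). Qed.

Fact tens_dd (n m l : int) (e : n = m + 1) (e' : m = l + 1) z :
  tens_d e' (tens_d e z) = 0.
Proof.
rewrite tens_dE (tens_dl_d e e' e e') !tens_dE raddfD tens_dr_dr tens_dl_dl.
by rewrite addr0 add0r addNr.
Qed.

Definition tensC : abcomplex := AbComplex tens_dd.

End TensorComplex.
Arguments tens_dl : simpl never.
Arguments tens_dr : simpl never.
Arguments tens_d : simpl never.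

Definition boundary (C : abcomplex) (n : int) : {pred C n} :=
  fun x => `[< exists y : C (n + 1), ad C (erefl _) y = x >].

Fact boundary_closed (C : abcomplex) n : zmod_closed (@boundary C n).
Proof.
split; first by apply/asboolP; exists 0; rewrite raddf0.
move=> _ _ /asboolP[x <-] /asboolP[y <-].
by apply/asboolP; exists (x - y); rewrite raddfB.
Qed.
HB.instance Definition _ (C : abcomplex) n :=
  GRing.isZmodClosed.Build (C n) (@boundary C n) (@boundary_closed C n).

Section ModifiedTensor.
Variables (R : pzRingType) (X : chcomplex R^c) (Y : chcomplex R).

Definition mtens_obj (n : int) : zmodType := Quotient.quot (@boundary (tensC X Y) n).

Fact mtens_d_subproof (n m : int) (e : n = m + 1) (z : tensC X Y n) :
  z \in @boundary (tensC X Y) n -> tens_dl X Y e z \in @boundary (tensC X Y) m.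
Proof.
move=> /asboolP[y <-]; apply/asboolP.
exists (- tens_dl X Y (congr1 (+%R^~ 1) e) y).
by rewrite raddfN [RHS](tens_dl_d _ _ (congr1 (+%R^~ 1) e) (erefl _)).
Qed.

(* the class of x (x) y |-> the class of dx (x) y *)
Definition mtens_d (n m : int) (e : n = m + 1) : {additive mtens_obj n -> mtens_obj m} :=
  quot_map (mtens_d_subproof e).

Fact mtens_dd (n m l : int) (e : n = m + 1) (e' : m = l + 1) z :
  mtens_d e' (mtens_d e z) = 0.
Proof. by rewrite -[z]reprK /mtens_d !quot_map_pi tens_dl_dl raddf0. Qed.

Definition mtensC : abcomplex := AbComplex mtens_dd.

End ModifiedTensor.
Arguments mtens_d : simpl never.

(* - (x) Y and the modified tensor product are functors of X *)
Section TensorFunctor.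
Variables (R : pzRingType) (X X' : chcomplex R^c) (f : chmap X X').
Variable Y : chcomplex R.

Definition tensC_map n : {additive tensC X Y n -> tensC X' Y n} :=
  dsum_map (u := id) (@inj_id (tpairs n))
    (fun p => tmap (f (val p).1) idfun : {additive _ -> _}).

Fact tensC_map_boundary n z :
  z \in @boundary (tensC X Y) n -> tensC_map n z \in @boundary (tensC X' Y) n.
Proof.
move=> /asboolP[y <-]; apply/asboolP; exists (tensC_map (n + 1) y).
apply: dsum_ext => p.
have E k (w : tensC X Y k) q :
  dsum_fun (tensC_map k w) q = tmap (f (val q).1) idfun (dsum_fun w q) by [].
have D k (a b : tens_obj X' Y k) q : dsum_fun (a + b) q = dsum_fun a q + dsum_fun b q.
  by [].
have D' k (a b : tens_obj X Y k) q : dsum_fun (a + b) q = dsum_fun a q + dsum_fun b q.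
  by [].
rewrite E [ad _ _ _]tens_dE [ad _ _ _]tens_dE D D' raddfD.
rewrite !tens_dlE !tens_drE !E raddfMz !tmap_comp.
congr (_ + _ *~ _); apply: tens_ext => a b; rewrite !tmap_pure //=.
by rewrite cmap_comm.
Qed.

Definition mtensC_map n : {additive mtensC X Y n -> mtensC X' Y n} :=
  quot_map (@tensC_map_boundary n).

End TensorFunctor.
Arguments tensC_map : simpl never.
Arguments mtensC_map : simpl never.

Section Modules.
Variable R : pzRingType.

Definition surj (A B : Type) (f : A -> B) : Prop := forall y, exists x, f x = y.

Definition mod_projective (P : lmodType R) : Prop :=
  forall (M N : lmodType R) (g : {linear M -> N}) (f : {linear P -> N}),
    surj g -> exists h : {linear P -> M}, forall x, g (h x) = f x.

Definition mod_fg (M : lmodType R) : Prop :=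
  exists (n : nat) (v : 'I_n -> M),
    forall x, exists c : 'I_n -> R, x = \sum_(i < n) c i *: v i.

Record mod_resolution (M : lmodType R) := ModResolution {
  mres :> nat -> lmodType R;
  mres_d : forall n, {linear mres n.+1 -> mres n};
  mres_aug : {linear mres 0%N -> M};
  mres_projective : forall n, mod_projective (mres n);
  mres_aug_surj : surj mres_aug;
  mres_exact0 : exact_at (mres_d 0%N) mres_aug;
  mres_exact : forall n, exact_at (mres_d n.+1) (mres_d n) }.

Definition mod_FPinfty (M : lmodType R) : Prop :=
  exists P : mod_resolution M, forall n, mod_fg (P n).

End Modules.

Section Complexes.
Variable R : pzRingType.

(* Epimorphisms of complexes are the degreewise surjective chain maps, and
   exactness of sequences of complexes is degreewise exactness.               *)

Definition ch_projective (P : chcomplex R) : Prop :=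
  forall (X Y : chcomplex R) (g : chmap X Y) (f : chmap P Y),
    (forall n, surj (g n)) ->
    exists h : chmap P X, forall n x, g n (h n x) = f n x.

Definition ch_fg (X : chcomplex R) : Prop :=
  (exists b : nat, forall n : int, (b < `|n|)%N -> forall x : X n, x = 0)
  /\ forall n, mod_fg (X n).

Record ch_resolution (X : chcomplex R) := ChResolution {
  cres :> nat -> chcomplex R;
  cres_d : forall i, chmap (cres i.+1) (cres i);
  cres_aug : chmap (cres 0%N) X;
  cres_projective : forall i, ch_projective (cres i);
  cres_aug_surj : forall n, surj (cres_aug n);
  cres_exact0 : forall n, exact_at (cres_d 0%N n) (cres_aug n);
  cres_exact : forall i n, exact_at (cres_d i.+1 n) (cres_d i n) }.

Definition ch_FPinfty (X : chcomplex R) : Prop :=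
  exists P : ch_resolution X, forall i, ch_fg (P i).

End Complexes.

(* Tor_1 is the homology at the spot 1 of P (x) N for a projective resolution
   P of the first variable; it does not depend on P, and neither does its
   vanishing.  Likewise for the derived functors of the modified tensor
   product.                                                                   *)

Definition Tor1_eq0 (R : pzRingType) (M : lmodType R^c) (N : lmodType R) : Prop :=
  forall P : mod_resolution M,
    exact_at (tmap (mres_d P 1) (idfun : {linear N -> N}))
             (tmap (mres_d P 0) (idfun : {linear N -> N})).

Definition mod_level (R : pzRingType) (N : lmodType R) : Prop :=
  forall M : lmodType R^c, mod_FPinfty M -> Tor1_eq0 M N.

Definition mTor1_eq0 (R : pzRingType) (X : chcomplex R^c) (Y : chcomplex R) : Prop :=
  forall (P : ch_resolution X) (n : int),
    exact_at (mtensC_map (cres_d P 1) Y n) (mtensC_map (cres_d P 0) Y n).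

Definition ch_level (R : pzRingType) (L : chcomplex R) : Prop :=
  forall X : chcomplex R^c, ch_FPinfty X -> mTor1_eq0 X L.

(* The two-sided sequence ... -> P_1 -> P_0 -> P^0 -> P^1 -> ... is indexed by
   int with P^k in degree - k and P_k in degree k + 1; the object is embedded
   in degree 0 by iota as the kernel of P^0 -> P^1.                           *)

Definition mod_GACproj (R : pzRingType) (N : lmodType R) : Prop :=
  exists (P : int -> lmodType R)
         (d : forall i j : int, i = j + 1 -> {linear P i -> P j})
         (iota : {linear N -> P 0}),
    [/\ forall i, mod_projective (P i),
        forall (i j k : int) (e : i = j + 1) (e' : j = k + 1),
          exact_at (d i j e) (d j k e'),
        injective iota
          /\ (forall (k : int) (e : 0 = k + 1), exact_at iota (d 0 k e))
      & forall L : lmodType R, mod_level L ->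
          forall (i j k : int) (e : i = j + 1) (e' : j = k + 1)
                 (f : {linear P j -> L}),
            (forall x, f (d i j e x) = 0) <->
            (exists g : {linear P k -> L}, forall x, g (d j k e' x) = f x)].

Definition ch_GACproj (R : pzRingType) (X : chcomplex R) : Prop :=
  exists (P : int -> chcomplex R)
         (d : forall i j : int, i = j + 1 -> chmap (P i) (P j))
         (iota : chmap X (P 0)),
    [/\ forall i, ch_projective (P i),
        forall (i j k : int) (e : i = j + 1) (e' : j = k + 1) n,
          exact_at (d i j e n) (d j k e' n),
        forall n, injective (iota n)
          /\ (forall (k : int) (e : 0 = k + 1), exact_at (iota n) (d 0 k e n))
      & forall L : chcomplex R, ch_level L ->
          forall (i j k : int) (e : i = j + 1) (e' : j = k + 1)
                 (f : chmap (P j) L),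
            (forall n x, f n (d i j e n x) = 0) <->
            (exists g : chmap (P k) L, forall n x, g n (d j k e' n x) = f n x)].

(* Main.v *)
From HB Require Import structures.
Require Import Defs.
From mathcomp Require Import all_boot all_order all_algebra.
From mathcomp Require Import boolp freeg.

(* Write G for the class of complexes X with Gorenstein AC-projective components
   and Hom(X, L) exact for every level L.

   Forward: given f : X -> L, the complete resolution of X is Hom(-, L)-exact, so
   f extends to P^0, and P^0 is contractible because it is projective; hence f is
   null homotopic.  The components are handled by testing the resolution against
   sums of disks on a level module, which are level complexes.

   Backward: every X in G sits in short exact sequences 0 -> K -> P -> X -> 0 and
   0 -> X -> P -> C -> 0 with P a projective sum of disks and K, C in G.  Both
   sequences are degreewise Hom(-, L_n)-exact, so Hom(K, L) and Hom(C, L) inherit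
   exactness from Hom(X, L) and from Hom(P, L), P being contractible.  The kernel
   and the cokernel are degreewise a syzygy plus a projective module; for the
   cokernel this uses that projective modules are level.  Splicing the sequences
   gives a complete resolution, which is Hom(-, L)-exact because a chain map
   K -> L is a cycle of Hom(K, L), and cycles lift along Hom(P, L) -> Hom(K, L)
   when Hom(X, L) is exact.

   Null homotopy of all chain maps to level complexes gives exactness of Hom(X, L)
   in all degrees because shifts of level complexes are level. *)

Set Implicit Arguments.
Unset Strict Implicit.
Unset Printing Implicit Defensive.

Import GRing.Theory.
Local Open Scope ring_scope.
Local Open Scope quotient_scope.

(** * Linear maps, kernels and projective modules *)

Section LinearConstructions.
Variable R : pzRingType.
Implicit Types U V W K P N : lmodType R.

Definition mklin U V (f : U -> V) (h : linear f) : {linear U -> V} :=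
  HB.pack f (GRing.isLinear.Build R U V *:%R f h).

Fact pairl_linear U V W (f : {linear U -> V}) (g : {linear U -> W}) :
  linear (fun x => (f x, g x)).
Proof. by move=> a x y /=; rewrite !linearP. Qed.
Definition pairl U V W (f : {linear U -> V}) (g : {linear U -> W}) :
  {linear U -> (V * W)%type} := mklin (pairl_linear f g).

Fact fstl_linear U V : linear (@fst U V). Proof. by []. Qed.
Definition fstl U V : {linear (U * V)%type -> U} := mklin (@fstl_linear U V).
Fact sndl_linear U V : linear (@snd U V). Proof. by []. Qed.
Definition sndl U V : {linear (U * V)%type -> V} := mklin (@sndl_linear U V).

Definition mapl U V U' V' (f : {linear U -> U'}) (g : {linear V -> V'}) :
  {linear (U * V)%type -> (U' * V')%type} := pairl (f \o fstl U V) (g \o sndl U V).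

(** Integer identities such as n - 1 + 1 = n do not hold by computation, so members of a family in
    equal degrees are compared through this cast. *)
Definition lcast (V : int -> lmodType R) i j (e : i = j) : {linear V i -> V j} :=
  let: erefl := e in idfun.

Lemma lcast_id (V : int -> lmodType R) i (e : i = i) x : lcast V e x = x.
Proof. by rewrite (Prop_irrelevance e erefl). Qed.

(** Extension by zero to the other degrees: [disk_in] takes a family of maps even when only one of
    them matters. *)
Lemma extend_family (V : int -> lmodType R) W n (f : {linear V n -> W}) :
  exists s : forall m, {linear V m -> W},
    s n = f /\ forall m, m <> n -> forall x, s m x = 0.
Proof.
pose s m : {linear V m -> W} :=
  if pselect (m = n) is left e then [the {linear _ -> _} of f \o lcast V e] else \0.
exists s; rewrite /s.
split=> [|m mn x]; case: pselect => // e.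
by apply: linear_ext => x /=; rewrite lcast_id.
Qed.

Lemma factor_inj U V W (f : {linear U -> W}) (i : {linear V -> W}) :
  injective i -> (forall x, exists y, i y = f x) ->
  exists g : {linear U -> V}, forall x, i (g x) = f x.
Proof.
move=> inj /choice[g gE].
have lg : linear g by move=> a x y; apply: inj; rewrite gE !linearP !gE.
by exists (mklin lg).
Qed.

Lemma factor_surj U V W (f : {linear V -> W}) (p : {linear V -> U}) :
  surj p -> (forall x, p x = 0 -> f x = 0) ->
  exists g : {linear U -> W}, forall x, g (p x) = f x.
Proof.
move=> /choice[s sE] ker.
have E x y : p x = p y -> f x = f y.
  by move=> h; apply/subr0_eq; rewrite -linearB ker // linearB h subrr.
have lg : linear (f \o s).
  by move=> a x y /=; rewrite -linearP; apply: E; rewrite linearP !sE.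
by exists (mklin lg) => x; apply: E; rewrite sE.
Qed.

Section Kernel.
Variables (U V : lmodType R) (f : {linear U -> V}).

Definition kerp : {pred U} := fun x => f x == 0.
Fact kerp_closed : submod_closed kerp.
Proof.
split; first by rewrite unfold_in raddf0.
by move=> a x y /eqP hx /eqP hy; rewrite unfold_in linearP hx hy scaler0 addr0.
Qed.
HB.instance Definition _ := GRing.isSubmodClosed.Build R U kerp kerp_closed.

Record ker := Ker { ker_val :> U; ker_mem : ker_val \in kerp }.
HB.instance Definition _ := [isSub for ker_val].
HB.instance Definition _ := [Choice of ker by <:].
HB.instance Definition _ := [SubChoice_isSubLmodule of ker by <:].

Fact kerl_linear : linear ker_val. Proof. by []. Qed.
Definition kerl : {linear ker -> U} := mklin kerl_linear.

Lemma kerl_inj : injective kerl. Proof. exact: val_inj. Qed.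

Lemma kerl_exact : exact_at kerl f.
Proof.
move=> y; split=> [/eqP fy|[[x hx] <-]]; last exact/eqP.
by exists (Ker fy).
Qed.

End Kernel.

Lemma projective_prod P Q :
  mod_projective P -> mod_projective Q -> mod_projective (P * Q)%type.
Proof.
move=> pP pQ M N g f gs.
have [h hE] := pP _ _ g (f \o pairl idfun \0) gs.
have [k kE] := pQ _ _ g (f \o pairl \0 idfun) gs.
have lhk : linear (fun p => h p.1 + k p.2).
  by move=> a x y; rewrite !linearP /= scalerDr addrACA.
exists (mklin lhk) => -[x y]; rewrite [LHS](linearD g) hE kE /= -linearD /=.
by congr (f _); congr pair => /=; rewrite ?addr0 ?add0r.
Qed.

End LinearConstructions.

(** * Syzygies and cosyzygies of Gorenstein AC-projective modules *)

Section GorensteinModules.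
Variable R : pzRingType.
Implicit Types K P Q N L : lmodType R.

(** For an injective [i] into a projective [P] with cokernel N, this says that Ext^1(N, L) = 0 for
    every level L. *)
Definition level_extends K P (i : {linear K -> P}) : Prop :=
  forall L, mod_level L -> forall f : {linear K -> L},
    exists g : {linear P -> L}, forall x, g (i x) = f x.

Record mod_ses K P N (i : {linear K -> P}) (p : {linear P -> N}) : Prop := ModSes {
  ses_projective : mod_projective P;
  ses_inj : injective i;
  ses_exact : exact_at i p;
  ses_surj : surj p;
  ses_level : level_extends i }.

Section CompleteResolution.
Variables (P : int -> lmodType R).
Variable d : forall i j : int, i = j + 1 -> {linear P i -> P j}.
Hypothesis Pproj : forall i, mod_projective (P i).
Hypothesis Pexact : forall (i j k : int) (e : i = j + 1) (e' : j = k + 1),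
  exact_at (d e) (d e').
Hypothesis Plevel : forall L, mod_level L ->
  forall (i j k : int) (e : i = j + 1) (e' : j = k + 1) (f : {linear P j -> L}),
    (forall x, f (d e x) = 0) <->
    (exists g : {linear P k -> L}, forall x, g (d e' x) = f x).

(** The differential out of P_i, corestricted to the kernel [N] of the next one, is onto by
    exactness; this cuts a complete resolution into short exact pieces. *)
Lemma complete_ses i j k (e : i = j + 1) (e' : j = k + 1) K N
    (u : {linear K -> P i}) (v : {linear N -> P j}) :
  injective u -> exact_at u (d e) -> injective v -> exact_at v (d e') ->
  exists p : {linear P i -> N}, mod_ses u p.
Proof.
move=> uinj uex vinj vex.
have [x|p pE] := factor_inj (f := d e) vinj.
  by have /vex := (Pexact e e' (d e x)).2 (ex_intro _ x erefl).
exists p; split=> //.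
- move=> y; rewrite -uex -pE; split=> [->|/eqP]; first exact: raddf0.
  by rewrite -(raddf0 v) (inj_eq vinj) => /eqP.
- move=> y; have [x dx] := (Pexact e e' _).1 ((vex (v y)).2 (ex_intro _ y erefl)).
  by exists x; apply: vinj; rewrite pE dx.
move=> L Ll f.
(* [c] is the surjection of P_(i+1) onto the kernel [K]; [f \o c] kills the image of the preceding
   differential and so factors through P_i. *)
have [x|c cE] := factor_inj (f := d (erefl (i + 1))) uinj.
  by have /uex := (Pexact erefl e (d erefl x)).2 (ex_intro _ x erefl).
have [z|g gE] := (Plevel Ll (erefl (i + 1 + 1)) (erefl (i + 1)) (f \o c)).1.
  suff h : c (d (erefl (i + 1 + 1)) z) = 0 by rewrite /= h raddf0.
  by apply: uinj; rewrite cE raddf0; apply/(Pexact erefl erefl); exists z.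
exists g => x; have [y yE] := (Pexact erefl e _).1 ((uex (u x)).2 (ex_intro _ x erefl)).
by rewrite -yE gE /=; congr (f _); apply: uinj; rewrite cE.
Qed.

(** The whole resolution, shifted by [i], is a complete resolution of this kernel. *)
Lemma GACproj_ker i j (e : i = j + 1) : mod_GACproj (ker (d e)).
Proof.
have shift m n : m = n + 1 -> m + i = n + i + 1 by move->; rewrite addrAC.
pose c := lcast P (esym (add0r i)).
exists (fun m => P (m + i)), (fun m n e' => d (shift m n e')), (c \o kerl (d e)).
split=> [m|h m n e1 e2||L Ll h m n e1 e2].
- exact: Pproj.
- exact: Pexact.
- rewrite /c; move: (esym (add0r i)) => ei.
  (* Generalising the target index lets the cast along 0 + i = i be eliminated by substitution. *)
  have D i' (ei' : i = i') j' (e' : i' = j' + 1) :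
      injective (lcast P ei' \o kerl (d e)) /\
      exact_at (lcast P ei' \o kerl (d e)) (d e').
    subst i'; have ej : j' = j by apply: (addIr 1); rewrite -e -e'.
    subst j'; rewrite (Prop_irrelevance e' e).
    by split; [exact: kerl_inj | exact: kerl_exact].
  split=> [|k ek]; first by have [] := D _ ei j (etrans (add0r i) e).
  by have [] := D _ ei _ (shift _ _ ek).
exact: Plevel.
Qed.

End CompleteResolution.

Lemma GACproj_syzygy N : mod_GACproj N ->
  exists (K P : lmodType R) (i : {linear K -> P}) (p : {linear P -> N}),
    mod_ses i p /\ mod_GACproj K.
Proof.
move=> [P [d [iota [Pp Pe [ii ie] Pl]]]].
have e : 1 = 0 + 1 :> int by []; have e' : 0 = -1 + 1 :> int by [].
have [p ps] := complete_ses Pp Pe Pl (e := e) (e' := e')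
  (@kerl_inj _ _ _ _) (@kerl_exact _ _ _ _) ii (ie _ _).
exists (ker (d 1 0 e)), (P 1), (kerl _), p; split=> //.
exact: GACproj_ker.
Qed.

Lemma GACproj_cosyzygy N : mod_GACproj N ->
  exists (P C : lmodType R) (i : {linear N -> P}) (p : {linear P -> C}),
    mod_ses i p /\ mod_GACproj C.
Proof.
move=> [P [d [iota [Pp Pe [ii ie] Pl]]]].
have e : 0 = -1 + 1 :> int by []; have e' : -1 = -2 + 1 :> int by [].
have [p ps] := complete_ses Pp Pe Pl (e := e) (e' := e')
  ii (ie _ _) (@kerl_inj _ _ _ _) (@kerl_exact _ _ _ _).
exists (P 0), (ker (d (-1) (-2) e')), iota, p; split=> //.
exact: GACproj_ker.
Qed.

(* The complete resolution of N is enlarged by the contractible complex with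
   Q * Q in every degree and differential (x, y) |-> (0, x). *)
Lemma GACproj_prod N Q :
  mod_GACproj N -> mod_projective Q -> mod_GACproj (N * Q)%type.
Proof.
move=> [P [d [iota [Pp Pe [ii ie] Pl]]]] Qp.
pose c : {linear (Q * Q)%type -> (Q * Q)%type} := pairl \0 (fstl Q Q).
exists (fun i => (P i * (Q * Q))%type), (fun i j e => mapl (d i j e) c),
  (mapl iota (pairl \0 idfun)).
split=> [i|i j k e e'||L Ll i j k e e' f].
- by do 2?apply: projective_prod.
- move=> [y [a b]]; split=> [[/(Pe _ _ _ e e')[x dx] a0]|[[x [a' b']] [<- <- <-]]].
    by exists (x, (b, 0)); congr (_, (_, _)); rewrite ?a0.
  by congr (_, (_, _)); apply/(Pe _ _ _ e e'); exists x.
- split=> [[x a] [y b] [/ii-> ->] //|k e [y [a b]]].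
  split=> [[/ie[x dx] a0]|[[x a'] [<- <- <-]]].
    by exists (x, b); congr (_, (_, _)).
  by congr (_, (_, _)); apply/ie; exists x.
have fE x a b : f (x, (a, b)) = f (x, 0) + f (0, (a, 0)) + f (0, (0, b)).
  by rewrite -!linearD /=; congr (f (_, (_, _))); rewrite /= ?addr0 ?add0r.
split=> [fd0|[g gE] [x [a b]]]; last first.
  rewrite -gE -[RHS](raddf0 g); congr (g (_, (_, _))).
  by apply/(Pe _ _ _ e e'); exists x.
have [x|g gE] := (Pl L Ll i j k e e' (f \o pairl idfun \0)).1.
  exact: fd0 (x, (0, 0)).
(* The differential moves [a] to the last slot, so [h] reads it there and returns f (0, (a, 0)). *)
pose h : {linear (Q * Q)%type -> L} := f \o pairl \0 (pairl (sndl Q Q) \0).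
have lg : linear (fun z : P k * (Q * Q) => g z.1 + h z.2).
  by move=> r y z; rewrite !linearP /= scalerDr addrACA.
exists (mklin lg) => -[x [a b]]; rewrite [RHS]fE /= gE /=.
have f0 : f (0, (0, b)) = 0.
  by rewrite -[RHS](fd0 (0, (b, 0))) /= linear0.
by rewrite f0 addr0.
Qed.

End GorensteinModules.

(** * Sums of disks and projective complexes *)

Section Complexes.
Variable R : pzRingType.
Implicit Types X Y P L : chcomplex R.
Implicit Types M N : int -> lmodType R.

Fact ch_comp_comm X Y Z (g : chmap Y Z) (f : chmap X Y) i j (e : i = j + 1) x :
  (g j \o f j) (cd X e x) = cd Z e ((g i \o f i) x).
Proof. by rewrite /= !cmap_comm. Qed.
Definition ch_comp X Y Z (g : chmap Y Z) (f : chmap X Y) : chmap X Z :=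
  ChMap (ch_comp_comm g f).

Definition ch_id X : chmap X X :=
  @ChMap R X X (fun=> idfun) (fun _ _ _ _ => erefl).

Definition disk_d M i j (e : i = j + 1) :
    {linear (M i * M (i + 1)%R)%type -> (M j * M (j + 1)%R)%type} :=
  pairl \0 (lcast M e \o fstl (M i) (M (i + 1))).

Fact disk_dd M i j k (e : i = j + 1) (e' : j = k + 1) x :
  disk_d M e' (disk_d M e x) = 0.
Proof. by rewrite /= linear0. Qed.

(* The sum over all n of the disks with M n in the degrees n and n - 1. *)
Definition disk M : chcomplex R := ChComplex (disk_dd (M := M)).

Lemma diskE M i j (e : i = j + 1) x : cd (disk M) e x = (0, lcast M e x.1).
Proof. by []. Qed.

Section DiskIn.
Variables (X : chcomplex R) (M : int -> lmodType R).
Variable s : forall n, {linear X n -> M (n + 1)}.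

(** A chain map into [disk M] amounts to arbitrary bottom components X_n -> M_(n+1): compatibility
    with d forces the top component in degree n to be the bottom one of degree n - 1 composed with
    d. *)
Definition disk_in_fun n : {linear X n -> disk M n} :=
  pairl (lcast M (subrK 1 n) \o s (n - 1) \o cd X (int_pred n)) (s n).

Lemma cd_lcast i j k (e : i = j + 1) (e' : i = k + 1) (h : k + 1 = j + 1) x :
  lcast M h (s k (cd X e' x)) = s j (cd X e x).
Proof.
have jk : k = j by apply: (addIr 1).
by subst k; rewrite lcast_id (Prop_irrelevance e' e).
Qed.

Fact disk_in_comm i j (e : i = j + 1) x :
  disk_in_fun j (cd X e x) = cd (disk M) e (disk_in_fun i x).
Proof.
rewrite diskE; apply: injective_projections => /=; first by rewrite cd_cd !linear0.
subst i; set h := subrK _ _.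
by rewrite [RHS](@cd_lcast (j + 1) j _ erefl).
Qed.

Definition disk_in : chmap X (disk M) := ChMap disk_in_comm.

End DiskIn.

Section DiskOut.
Variables (M : int -> lmodType R) (Y : chcomplex R).
Variable a : forall n, {linear M n -> Y n}.

Fact disk_out_linear n :
  linear (fun z : disk M n => a n z.1 + cd Y erefl (a (n + 1) z.2)).
Proof. by move=> r x y; rewrite !linearP /= scalerDr addrACA. Qed.

Fact disk_out_comm i j (e : i = j + 1) x :
  mklin (@disk_out_linear j) (cd (disk M) e x)
  = cd Y e (mklin (@disk_out_linear i) x).
Proof. by subst i; rewrite /= linear0 add0r linearD cd_cd addr0. Qed.

(** Dually, a chain map out of [disk M] amounts to arbitrary maps on the top components, since each
    bottom element is the differential of a top one. *)
Definition disk_out : chmap (disk M) Y := ChMap disk_out_comm.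

End DiskOut.

Lemma disk_outE M Y (a : forall n, {linear M n -> Y n}) n x y :
  disk_out a n (x, y) = a n x + cd Y erefl (a (n + 1) y).
Proof. by []. Qed.

Lemma disk_out_surj M Y (a : forall n, {linear M n -> Y n}) :
  (forall n, surj (a n)) -> forall n, surj (disk_out a n).
Proof.
move=> h n y; have [x <-] := h n y; exists (x, 0).
by rewrite disk_outE !linear0 addr0.
Qed.

(** Only the top components need lifting, and these are projective modules. *)
Lemma disk_projective M :
  (forall n, mod_projective (M n)) -> ch_projective (disk M).
Proof.
move=> Mp X Y g f gs.
have /(_ _)/cid-b n : exists b : {linear M n -> X n},
    forall x, g n (b x) = f n (x, 0).
  exact: Mp (g n) (f n \o pairl idfun \0) (gs n).
exists (disk_out (fun n => sval (b n))) => n [x y].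
rewrite disk_outE linearD cmap_comm !(svalP (b _)) -cmap_comm -linearD diskE /=.
by congr (f _ _); apply: injective_projections; rewrite /= ?addr0 ?add0r.
Qed.

(** Through [disk_in], a lifting problem for P_n becomes one for [P] against a surjection of sums of
    disks; the answer is the bottom component in degree n. *)
Lemma projective_cobj P n : ch_projective P -> mod_projective (P n).
Proof.
move=> Pp U V g f gs.
have [s [sn _]] := extend_family f.
have Gc i j (e : i = j + 1) x : mapl g g (cd (disk (fun=> U)) e x)
    = cd (disk (fun=> V)) e (mapl g g x).
  by subst i; apply: injective_projections; rewrite /= ?linear0.
have [|h hE] := Pp _ _ (@ChMap _ (disk _) (disk _) (fun=> mapl g g) Gc) (disk_in s).
  by move=> m [x y]; have [x' <-] := gs x; have [y' <-] := gs y; exists (x', y').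
exists (sndl U U \o h n) => x.
by have := congr1 snd (hE n x); rewrite /= => ->; rewrite sn.
Qed.

(** The identities of the P_n induce a surjection from [disk P] to P. It splits, and the bottom
    component of the splitting is a contracting homotopy. *)
Lemma projective_contractible P : ch_projective P -> null_homotopic (ch_id P).
Proof.
move=> Pp; have [|h hE] := Pp _ _ (disk_out (M := P) (fun=> idfun)) (ch_id P).
  by apply: disk_out_surj => n y; exists y.
pose s i j (e : j = i + 1) : {linear P i -> P j} :=
  lcast P (esym e) \o (sndl (P i) (P (i + 1)) \o h i).
exists s => i j k e e' x; subst i j.
have := hE (k + 1) x; case E: (h (k + 1) x) => [a b].
rewrite disk_outE /= => xE; rewrite -[LHS]xE [LHS]addrC; congr (_ + _).
  by rewrite /s /= E.
by rewrite /s /= (cmap_comm h) E diskE.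
Qed.

Lemma contractible_null P Y (f : chmap P Y) :
  null_homotopic (ch_id P) -> null_homotopic f.
Proof.
move=> [s sE]; exists (fun i j e => f j \o s i j e) => i j k e e' x.
by rewrite /= -cmap_comm -linearD -sE.
Qed.

Lemma subcomplex P (K : int -> lmodType R) (u : forall n, {linear K n -> P n}) :
  (forall n, injective (u n)) ->
  (forall i j (e : i = j + 1) x, exists y, u j y = cd P e (u i x)) ->
  exists (d : forall i j, i = j + 1 -> {linear K i -> K j})
      (dd : forall i j k (e : i = j + 1) (e' : j = k + 1) x,
         d j k e' (d i j e x) = 0)
      (v : chmap (ChComplex dd) P),
    forall n x, v n x = u n x.
Proof.
move=> ui ue.
have /(_ _ _ _)/cid-d i j e := factor_inj (f := cd P e \o u i) (ui j) (ue i j e).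
have dE i j e x : u j (sval (d i j e) x) = cd P e (u i x) by rewrite (svalP (d i j e)).
have dd i j k (e : i = j + 1) (e' : j = k + 1) x :
    sval (d j k e') (sval (d i j e) x) = 0.
  by apply: ui; rewrite !dE cd_cd linear0.
by exists (fun i j e => sval (d i j e)), dd, (@ChMap _ (ChComplex dd) P u dE).
Qed.

Lemma quotient_complex P (C : int -> lmodType R) (q : forall n, {linear P n -> C n}) :
  (forall n, surj (q n)) ->
  (forall i j (e : i = j + 1) x, q i x = 0 -> q j (cd P e x) = 0) ->
  exists (d : forall i j, i = j + 1 -> {linear C i -> C j})
      (dd : forall i j k (e : i = j + 1) (e' : j = k + 1) x,
         d j k e' (d i j e x) = 0)
      (v : chmap P (ChComplex dd)),
    forall n x, v n x = q n x.
Proof.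
move=> qs qe.
have /(_ _ _ _)/cid-d i j e := factor_surj (f := q j \o cd P e) (qs i) (qe i j e).
have dE i j e x : q j (cd P e x) = sval (d i j e) (q i x) by rewrite (svalP (d i j e)).
have dd i j k (e : i = j + 1) (e' : j = k + 1) x :
    sval (d j k e') (sval (d i j e) x) = 0.
  by have [y <-] := qs i x; rewrite -!dE cd_cd linear0.
by exists (fun i j e => sval (d i j e)), dd, (@ChMap _ P (ChComplex dd) q dE).
Qed.

Lemma ch_factor_inj X Y P (f : chmap X P) (u : chmap Y P) :
  (forall n, injective (u n)) -> (forall n x, exists y, u n y = f n x) ->
  exists g : chmap X Y, forall n x, u n (g n x) = f n x.
Proof.
move=> ui uf; have /(_ _)/cid-g n := factor_inj (f := f n) (ui n) (uf n).
have gE n x : u n (sval (g n) x) = f n x by rewrite (svalP (g n)).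
have gc i j (e : i = j + 1) x :
    sval (g j) (cd X e x) = cd Y e (sval (g i) x).
  by apply: ui; rewrite gE !cmap_comm gE.
by exists (ChMap gc).
Qed.

Lemma ch_factor_surj X Y P (f : chmap P Y) (q : chmap P X) :
  (forall n, surj (q n)) -> (forall n x, q n x = 0 -> f n x = 0) ->
  exists g : chmap X Y, forall n x, g n (q n x) = f n x.
Proof.
move=> qs qf; have /(_ _)/cid-g n := factor_surj (f := f n) (qs n) (qf n).
have gE n x : sval (g n) (q n x) = f n x by rewrite (svalP (g n)).
have gc i j (e : i = j + 1) x :
    sval (g j) (cd X e x) = cd Y e (sval (g i) x).
  by have [y <-] := qs i x; rewrite -cmap_comm !gE cmap_comm.
by exists (ChMap gc).
Qed.

End Complexes.

(** * Exactness in a short exact sequence of complexes *)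

Section ShortExactSequence.
Variables (A B C : abcomplex).
Variables (a : forall n, {additive A n -> B n}) (b : forall n, {additive B n -> C n}).
Hypothesis a_comm : forall i j (e : i = j + 1) x, a j (ad A e x) = ad B e (a i x).
Hypothesis b_comm : forall i j (e : i = j + 1) x, b j (ad B e x) = ad C e (b i x).
Hypothesis a_inj : forall n, injective (a n).
Hypothesis ab_ex : forall n, exact_at (a n) (b n).
Hypothesis b_surj : forall n, surj (b n).

Let ba0 n x : b n (a n x) = 0.
Proof. by apply/ab_ex; exists x. Qed.

(** For any lift y of c, the boundary of y comes from a cycle of A; as A is exact, that cycle bounds
    some x', and y - a x' is the required cycle. *)
Lemma lift_cycle j k (e : j = k + 1) c : ab_exact A -> ad C e c = 0 ->
  exists2 y, b j y = c & ad B e y = 0.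
Proof.
move=> Aex dc; have [y yE] := b_surj c.
have [x xE] := (ab_ex (ad B e y)).1 (etrans (b_comm e y) (etrans (congr1 _ yE) dc)).
have [|x' x'E] := (Aex _ _ (k - 1) e (int_pred k) x).1.
  by apply: a_inj; rewrite a_comm xE ad_ad raddf0.
exists (y - a j x'); first by rewrite raddfB ba0 yE subr0.
by rewrite raddfB -a_comm x'E xE subrr.
Qed.

Lemma ab_exact_quotient : ab_exact A -> ab_exact B -> ab_exact C.
Proof.
move=> Aex Bex i j k e e' c; split=> [dc|[x <-]]; last exact: ad_ad.
have [y <- dy] := lift_cycle Aex dc.
have [y' <-] := (Bex _ _ _ e e' y).1 dy.
by exists (b i y'); rewrite b_comm.
Qed.

Lemma ab_exact_sub : ab_exact B -> ab_exact C -> ab_exact A.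
Proof.
move=> Bex Cex i j k e e' x; split=> [dx|[y <-]]; last exact: ad_ad.
have [|y yE] := (Bex _ _ _ e e' (a j x)).1; first by rewrite -a_comm dx raddf0.
(* The element y bounding a x maps to a cycle of C, which bounds some c; subtracting from y the
   boundary of a lift of c moves y into A without changing its own boundary. *)
have [|c cE] := (Cex (i + 1) _ _ erefl e (b i y)).1.
  by rewrite -b_comm yE ba0.
have [y' y'E] := b_surj c.
have [|x' x'E] := (ab_ex (y - ad B erefl y')).1.
  by rewrite raddfB b_comm y'E cE subrr.
exists x'; apply: a_inj; rewrite a_comm x'E raddfB ad_ad subr0.
exact: yE.
Qed.

End ShortExactSequence.

(** * The complex Hom(X, L): functoriality, cycles and null homotopies *)

Section HomComplex.
Variable R : pzRingType.
Implicit Types X Y P L : chcomplex R.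

(* Free indices avoid transport along i - 1 + 1 = i. *)
Lemma hom_d_comp X L n m (e : n = m + 1) (f : hom_obj X L n) i j i' j'
    (ei : i = i' + 1) (ej : j = j' + 1) h h' (h'' : j' == i + m) x :
  hom_d X L e f (exist _ (i, j') h'') x =
  cd L ej (f (exist _ (i, j) h) x)
  - f (exist _ (i', j') h') (cd X ei x) *~ sgn n.
Proof.
have ii : i' = i - 1 by rewrite ei addrK.
subst j i' n; rewrite hom_dE /= (Prop_irrelevance ei (int_pred i)).
rewrite /hom_up /hom_dn /=; congr (cd L _ _ - _ *~ _); exact: hom_irr.
Qed.

Lemma hom_cycle X L n m (e : n = m + 1) (f : hom_obj X L n) :
  hom_d X L e f = 0 -> forall i j i' j'
    (ei : i = i' + 1) (ej : j = j' + 1) h h' x,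
  cd L ej (f (exist _ (i, j) h) x)
  = f (exist _ (i', j') h') (cd X ei x) *~ sgn n.
Proof.
move=> df i j i' j' ei ej h h' x; apply/subr0_eq.
have h'' : j' == i + m by apply/eqP/(addIr 1); rewrite -addrA -e -ej; exact/eqP.
by rewrite -(@hom_d_comp _ _ _ _ e f _ _ _ _ ei ej h h' h'') df.
Qed.

Section Pull.
Variables (X Y L : chcomplex R) (f : chmap X Y).

Definition hom_pull_fun n (g : hom_obj Y L n) : hom_obj X L n :=
  fun p => g p \o f (val p).1.
Fact hom_pull_additive n : zmod_morphism (@hom_pull_fun n).
Proof. by move=> g h; apply: hom_ext. Qed.
Definition hom_pull n : {additive homC Y L n -> homC X L n} :=
  HB.pack (@hom_pull_fun n)
    (GRing.isZmodMorphism.Build _ _ (@hom_pull_fun n) (@hom_pull_additive n)).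

Lemma hom_pull_comm i j (e : i = j + 1) g :
  hom_pull j (ad (homC Y L) e g) = ad (homC X L) e (hom_pull i g).
Proof.
apply: hom_ext => p x.
by rewrite [LHS](@hom_dE _ _ _ _ _ e g p (f _ x)) [RHS](@hom_dE _ _ _ _ _ e _ p x) /=
  cmap_comm.
Qed.

End Pull.

Section HomExact.
Variables (K P X L : chcomplex R) (u : chmap K P) (p : chmap P X).
Hypothesis p_surj : forall n, surj (p n).
Hypothesis up_ex : forall n, exact_at (u n) (p n).
Hypothesis u_ext : forall n m (f : {linear K n -> L m}),
  exists g : {linear P n -> L m}, forall x, g (u n x) = f x.

Lemma hom_pull_inj n : injective (hom_pull L p n).
Proof.
move=> f g fg; apply: hom_ext => q y; have [x <-] := p_surj y.
by have := congr1 (fun h : hom_obj P L n => h q x) fg.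
Qed.

Lemma hom_pull_exact n : exact_at (hom_pull L p n) (hom_pull L u n).
Proof.
move=> f; split=> [fu|[g <-]].
  have /(_ _)/cid-g q : exists g : {linear X (val q).1 -> L (val q).2},
      forall x, g (p _ x) = f q x.
    apply: factor_surj => // x /up_ex[y <-].
    by have := congr1 (fun h : hom_obj K L n => h q y) fu.
  by exists (fun q => sval (g q)); apply: hom_ext => q x; rewrite -(svalP (g q)).
apply: hom_ext => q x /=.
have -> : p _ (u _ x) = 0 by apply/up_ex; exists x.
exact: linear0.
Qed.

Lemma hom_pull_surj n : surj (hom_pull L u n).
Proof.
move=> f; have /(_ _)/cid-g q := u_ext (f q).
by exists (fun q => sval (g q)); apply: hom_ext => q x; rewrite -(svalP (g q)).
Qed.

End HomExact.

Lemma homC_contractible P L : null_homotopic (ch_id P) -> ab_exact (homC P L).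
Proof.
move=> [s sE] n m k e e' f; split=> [df|[g <-]]; last exact: hom_dd.
have up (q : hpairs n) : (val q).2 == (val q).1 + 1 + m.
  by case: q => -[a b] /= /eqP->; rewrite e -addrA [m + 1]addrC.
(* Precomposition with the contraction [s]. As d f = (-1)^m f d for the cycle f, the sign (-1)^m
   makes the boundary of g equal to f (d s + s d) = f. *)
pose g : hom_obj P L n := fun q =>
  [the {linear _ -> _} of f (exist _ ((val q).1 + 1, (val q).2) (up q))
     \o s (val q).1 ((val q).1 + 1) erefl] *~ sgn m.
have gE q x : g q x =
    f (exist _ ((val q).1 + 1, (val q).2) (up q)) (s (val q).1 _ erefl x) *~ sgn m.
  exact: linear_mulzE.
have aux a b c (e1 : a = b + 1) h h' y :
    f (exist _ (b + 1, c) h) (s b (b + 1) erefl y) = f (exist _ (a, c) h') (s b a e1 y).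
  by subst a; exact: hom_irr.
exists g; apply: hom_ext => -[[i j] h] x /=; have /= hE := eqP h.
have h1 : j + 1 == i + n by rewrite e hE addrA.
have h2 : j == i - 1 + n by rewrite e [m + 1]addrC addrA subrK.
rewrite [LHS](@hom_d_comp _ _ _ _ e g i (j + 1) (i - 1) j (int_pred i) erefl h1 h2).
rewrite !gE /=.
rewrite raddfMz.
have h3 : j == i - 1 + 1 + m by rewrite subrK.
rewrite [X in X *~ _ - _](@hom_cycle _ _ _ _ e' f df _ _ i j erefl erefl _ h).
have -> : sgn n = - sgn m by rewrite e sgnS.
rewrite mulrNz opprK -!mulrzA.
have ss : sgn m * sgn m = 1 by case: (sgnP m) => ->.
rewrite ss !mulr1z.
rewrite [X in _ + X](aux i (i - 1) j (int_pred i) _ h).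
by rewrite -linearD -sE.
Qed.

Fact shift_subproof (k i j : int) : i = j + 1 -> i + k = j + k + 1.
Proof. by move->; rewrite addrAC. Qed.

(** The differential is taken without the usual sign (-1)^k; [homC_exact_shift] puts the signs into
    the maps instead. *)
Definition shift k L : chcomplex R :=
  @ChComplex R (fun n => L (n + k)) (fun i j e => cd L (shift_subproof k e))
    (fun i j l e e' x => cd_cd (shift_subproof k e) (shift_subproof k e') x).

(** Together with [cycle_chmap] this identifies chain maps with the 0-cycles of Hom(X, L). A pair
    (i, j) of degree 0 satisfies j = i + 0 only propositionally, whence the cast. *)
Lemma chmap_cycle X L (f : chmap X L) m (e : 0 = m + 1) :
  exists phi : homC X L 0, ad (homC X L) e phi = 0
    /\ forall i h x, phi (exist _ (i, i) h) x = f i x.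
Proof.
have E (q : hpairs 0) : (val q).1 = (val q).2 by rewrite (eqP (valP q)) addr0.
pose phi : homC X L 0 := fun q => lcast L (E q) \o f (val q).1.
have phiE i h x : phi (exist _ (i, i) h) x = f i x by rewrite /= lcast_id.
exists phi; split=> //; apply: hom_ext => -[[i j] h] x /=; have /= hE := eqP h.
have h1 : j + 1 == i + 0 by rewrite e hE addrA.
have h2 : j == i - 1 + 0.
  by rewrite addr0; apply/eqP/(addIr 1); rewrite (eqP h1 : j + 1 = i + 0) addr0 subrK.
rewrite [LHS](@hom_d_comp _ _ _ _ e phi i (j + 1) (i - 1) j (int_pred i) erefl h1 h2).
have ij : i = j + 1 by rewrite (eqP h1 : j + 1 = i + 0) addr0.
have ij' : i - 1 = j by rewrite ij addrK.
move: (int_pred i) h2; move: (i - 1) ij' => i' ?; subst i' i => e1 h2.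
by rewrite !phiE mulr1z cmap_comm (Prop_irrelevance e1 erefl) subrr.
Qed.

Lemma cycle_chmap X L m (e : 0 = m + 1) (phi : homC X L 0) :
  ad (homC X L) e phi = 0 ->
  exists f : chmap X L, forall i h x, phi (exist _ (i, i) h) x = f i x.
Proof.
move=> dphi; have D (i : int) : i == i + 0 by rewrite addr0.
have c i j (e' : i = j + 1) x :
    phi (exist _ (j, j) (D j)) (cd X e' x) = cd L e' (phi (exist _ (i, i) (D i)) x).
  by rewrite (@hom_cycle _ _ _ _ e phi dphi _ _ _ _ e' e' _ (D j)) mulr1z.
by exists (@ChMap _ X L (fun i => phi (exist _ (i, i) (D i))) c) => i h x;
  exact: hom_irr.
Qed.

(** A cycle of degree n commutes with d up to (-1)^n. Multiplying its component at i by (-1)^(n i)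
    gives a chain map to [shift n L], and a null homotopy of that map, with the same signs, gives a
    bounding element. *)
Lemma homC_exact_shift X L :
  (forall k (f : chmap X (shift k L)), null_homotopic f) -> ab_exact (homC X L).
Proof.
move=> XL n' n m e' e phi; split=> [dphi|[g <-]]; last exact: hom_dd.
pose F i : {linear X i -> shift n L i} :=
  phi (exist _ (i, i + n) (eqxx _)) *~ sgn (n * i).
have FE i x : F i x = phi (exist _ (i, i + n) (eqxx _)) x *~ sgn (n * i).
  exact: linear_mulzE.
have sD a b : sgn (a + b) = sgn a * sgn b by rewrite /sgn exprzDr.
have ss a : sgn a * sgn a = 1 by case: (sgnP a) => ->.
have Fc i j (ei : i = j + 1) x : F j (cd X ei x) = cd (shift n L) ei (F i x).
  rewrite !FE [RHS]raddfMz /=.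
  rewrite (@hom_cycle _ _ _ _ e phi dphi i _ j _ ei _ _ (eqxx _)).
  have nE : sgn (n * i) = sgn (n * j) * sgn n by rewrite ei mulrDr mulr1 sD.
  by rewrite -mulrzA nE mulrCA ss mulr1.
have [s sE] := XL n (ChMap Fc).
have E (q : hpairs n') : (val q).1 + 1 + n = (val q).2.
  by case: q => -[a b] /= /eqP->; rewrite e' addrAC addrA.
pose psi : homC X L n' := fun q =>
  [the {linear _ -> _} of lcast L (E q) \o s (val q).1 ((val q).1 + 1) erefl]
    *~ sgn (n * (val q).1).
have psiE i j (ej : j = i + 1) h x :
    psi (exist _ (i, j + n) h) x = s i j ej x *~ sgn (n * i).
  by subst j; rewrite [LHS]linear_mulzE /= lcast_id.
exists psi; apply: hom_ext => -[[i j'] h] x.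
have j'E := eqP h; rewrite /= in j'E; subst j'.
have h1 : i + 1 + n == i + n' by rewrite e' addrAC addrA.
have h2 : i + n == i - 1 + n' by rewrite e' [n + 1]addrC addrA subrK.
rewrite [LHS](@hom_d_comp _ _ _ _ e' psi i (i + 1 + n) (i - 1) (i + n) (int_pred i)
  (shift_subproof n erefl) h1 h2).
rewrite (psiE i _ erefl) (psiE (i - 1) i (int_pred i)) raddfMz.
have -> : sgn n' = - sgn n by rewrite e' sgnS.
have nE : n * i = n * (i - 1) + n by rewrite mulrBr mulr1 subrK.
rewrite mulrNz opprK -mulrzA -sD -nE -mulrzDl.
have := sE (i + 1) i (i - 1) erefl (int_pred i) x; rewrite /= FE => <-.
by rewrite -mulrzA ss mulr1z; exact: hom_irr.
Qed.

End HomComplex.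

(** * Tensor products of modules: induction, universal property, functoriality *)

Section TensorProduct.
Variable R : pzRingType.

Section Universal.
Variables (M : lmodType R^c) (N : lmodType R).

Lemma tens_ind (P : tens M N -> Prop) :
  (forall m n, P (tpure m n)) -> (forall x y, P x -> P y -> P (x - y)) ->
  forall t, P t.
Proof.
move=> P1 PB t.
have P0 : P 0 by rewrite -(tpure0l M (0 : N)); exact: P1.
have PN x : P x -> P (- x) by move=> Px; rewrite -[- x]add0r; exact: PB.
have PD x y : P x -> P y -> P (x + y).
  by move=> Px Py; rewrite -[y]opprK; apply: PB => //; apply: PN.
rewrite -[t]reprK -[repr t]freeg_sumE raddf_sum.
elim/big_ind: _ => // -[m n] _.
rewrite -[coeff _ _]intz -freegU_mulz raddfMz -/(tpure m n).
have Pn k : P (tpure m n *+ k) by elim: k => // k IH; rewrite mulrS; apply: PD.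
by case: (coeff _ _) => k; rewrite ?NegzE ?mulrNz -pmulrn; [|apply: PN]; apply: Pn.
Qed.

Variables (A : zmodType) (f : M -> N -> A).
Hypothesis fDl : forall m m' n, f (m + m') n = f m n + f m' n.
Hypothesis fDr : forall m n n', f m (n + n') = f m n + f m n'.
Hypothesis fZ : forall (r : R) m n, f ((r : R^c) *: m) n = f m (r *: n).

Let h := free_lift (fun p : (M * N)%type => f p.1 p.2).

Fact tens_lift_subproof x : x \in @tens_sub R M N -> h x = 0.
Proof.
move=> /asboolP; elim=> [|{}x y _ hx _ hy|m m' n|m n n'|r m n].
- exact: raddf0.
- by rewrite raddfB hx hy subr0.
- by rewrite !raddfB !free_liftU /= fDl [_ + f _ _]addrC addrK subrr.
- by rewrite !raddfB !free_liftU /= fDr [_ + f _ _]addrC addrK subrr.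
- by rewrite !raddfB !free_liftU /= fZ subrr.
Qed.

Definition tens_lift : {additive tens M N -> A} := quot_lift tens_lift_subproof.

Lemma tens_lift_pure m n : tens_lift (tpure m n) = f m n.
Proof. by rewrite [LHS](quot_lift_pi tens_lift_subproof) free_liftU. Qed.

End Universal.

Lemma tmap_id (M : lmodType R^c) (N : lmodType R) t :
  tmap (idfun : {linear M -> M}) (idfun : {linear N -> N}) t = t.
Proof.
by apply: (@tens_ext _ _ _ _ (tmap _ _) idfun) => m n; exact: tmap_pure.
Qed.

Lemma tmapDr (M M' : lmodType R^c) (N N' : lmodType R) (f : {linear M -> M'})
    (g g' g'' : {linear N -> N'}) t :
  (forall n, g'' n = g n + g' n) -> tmap f g'' t = tmap f g t + tmap f g' t.
Proof.
move=> gE; apply: (@tens_ext _ _ _ _ (tmap f g'') (tmap f g \+ tmap f g')) => m n.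
by rewrite [LHS]tmap_pure gE tpureDr -!(tmap_pure f).
Qed.

Lemma eq_tmap (M M' : lmodType R^c) (N N' : lmodType R)
    (f f' : {linear M -> M'}) (g g' : {linear N -> N'}) t :
  f =1 f' -> g =1 g' -> tmap f g t = tmap f' g' t.
Proof.
by move=> ff gg; apply: tens_ext => m n; rewrite !tmap_pure ff gg.
Qed.

Lemma tmap_exchange (M M' : lmodType R^c) (N N' : lmodType R)
    (f : {linear M -> M'}) (g : {linear N -> N'}) t :
  tmap f idfun (tmap idfun g t) = tmap idfun g (tmap f idfun t).
Proof. by rewrite !tmap_comp; apply: eq_tmap. Qed.

End TensorProduct.

(** * Free modules, dual bases and levelness of projective modules *)

Lemma sum_support (S : eqType) (V : zmodType) (F : S -> V) (s t : seq S) :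
  uniq s -> uniq t -> (forall i, i \notin s -> F i = 0) ->
  (forall i, i \notin t -> F i = 0) ->
  \sum_(i <- s) F i = \sum_(i <- t) F i.
Proof.
move=> us ut Fs Ft.
have E u : \sum_(i <- u) F i = \sum_(i <- [seq i <- u | F i != 0]) F i.
  rewrite big_filter (bigID (fun i => F i == 0)) /= big1 ?add0r //.
  by move=> i /eqP.
rewrite (E s) (E t); apply: perm_big; apply: uniq_perm; rewrite ?filter_uniq //.
move=> i; rewrite !mem_filter; case: eqP => //= Fi.
by apply/idP/idP => _; apply/negPn/negP; [move/Ft | move/Fs].
Qed.

Section FreeModule.
Variables (R : pzRingType) (S : eqType).

Definition freemod : Type := dsum (fun _ : S => R).
HB.instance Definition _ := GRing.Zmodule.on freemod.

Fact freemod_scale_subproof (a : R) (f : freemod) :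
  (fun i => a * dsum_fun f i) \in @finsupp S (fun=> R).
Proof.
case: f => f /= /asboolP[s hs]; apply/asboolP; exists s => i /hs ->.
exact: mulr0.
Qed.
Definition freemod_scale a f : freemod := DSum (freemod_scale_subproof a f).

Fact freemod_scaleA a b f :
  freemod_scale a (freemod_scale b f) = freemod_scale (a * b) f.
Proof. by apply: dsum_ext => i /=; rewrite mulrA. Qed.
Fact freemod_scale1 : left_id 1 freemod_scale.
Proof. by move=> f; apply: dsum_ext => i /=; rewrite mul1r. Qed.
Fact freemod_scaleDr : right_distributive freemod_scale +%R.
Proof. by move=> a f g; apply: dsum_ext => i; exact: mulrDr. Qed.
Fact freemod_scaleDl f : {morph freemod_scale^~ f : a b / a + b}.
Proof. by move=> a b; apply: dsum_ext => i; exact: mulrDl. Qed.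
HB.instance Definition _ := GRing.Zmodule_isLmodule.Build R freemod
  freemod_scaleA freemod_scale1 freemod_scaleDr freemod_scaleDl.

Fact freemod_coord_linear i : linear (fun f : freemod => dsum_fun f i : R^o).
Proof. by []. Qed.
Definition freemod_coord i : {linear freemod -> R^o} := mklin (freemod_coord_linear i).

Lemma freemod_support (f : freemod) :
  exists2 s : seq S, uniq s & forall i, i \notin s -> dsum_fun f i = 0.
Proof.
have /asboolP[s hs] := dsum_finsupp f.
by exists (undup s) => [|i]; rewrite ?undup_uniq ?mem_undup //; exact: hs.
Qed.

(** The value may be computed on any list that contains the support, so linearity can be checked on
    a list common to two elements. *)
Lemma freemod_lift (N : lmodType R) (v : S -> N) :
  exists F : {linear freemod -> N}, forall (f : freemod) s, uniq s ->
    (forall i, i \notin s -> dsum_fun f i = 0) ->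
    F f = \sum_(i <- s) dsum_fun f i *: v i.
Proof.
pose supp f := s2val (cid2 (freemod_support f)).
have supp_u f : uniq (supp f) := s2valP (cid2 (freemod_support f)).
have supp0 f : forall i, i \notin supp f -> dsum_fun f i = 0 :=
  s2valP' (cid2 (freemod_support f)).
pose F f := \sum_(i <- supp f) dsum_fun f i *: v i.
have FE f s : uniq s -> (forall i, i \notin s -> dsum_fun f i = 0) ->
    F f = \sum_(i <- s) dsum_fun f i *: v i.
  move=> us hs; apply: sum_support => // i hi; first by rewrite supp0 ?scale0r.
  by rewrite hs ?scale0r.
have Fl : linear F.
  move=> a f g; pose s := undup (supp f ++ supp g).
  have us : uniq s by exact: undup_uniq.
  have sf i : i \notin s -> dsum_fun f i = 0.
    by rewrite mem_undup mem_cat negb_or => /andP[/supp0].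
  have sg i : i \notin s -> dsum_fun g i = 0.
    by rewrite mem_undup mem_cat negb_or => /andP[_ /supp0].
  have E i : dsum_fun (a *: f + g) i = a * dsum_fun f i + dsum_fun g i by [].
  rewrite (FE _ s us) => [|i hi]; last by rewrite [LHS]E sf // sg // mulr0 addr0.
  rewrite (FE f s) // (FE g s) // scaler_sumr -big_split /=.
  by apply: eq_bigr => i _; rewrite [X in X *: _]E scalerDl scalerA.
by exists (mklin Fl).
Qed.

Fact freemod_unit_subproof i :
  (fun j => if j == i then 1 else 0) \in @finsupp S (fun=> R).
Proof. by apply/asboolP; exists [:: i] => j; rewrite inE => /negbTE->. Qed.
Definition freemod_unit i : freemod := DSum (freemod_unit_subproof i).

End FreeModule.

(** These are the coordinates of a splitting of the canonical surjection onto [N] from the free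
    module on the elements of N. Larger duplicate-free lists are allowed so that several elements
    can share one. *)
Lemma dual_basis (R : pzRingType) (N : lmodType R) : mod_projective N ->
  exists h : N -> {linear N -> R^o}, forall n, exists s : seq N,
    forall s' : seq N, uniq s' -> {subset s <= s'} -> n = \sum_(i <- s') (h i n : R) *: i.
Proof.
move=> Np; have [F FE] := freemod_lift (fun n : N => n).
have [n|g gE] := Np _ _ F idfun.
  exists (freemod_unit R n); rewrite (FE _ [:: n]) // => [|i].
    by rewrite big_seq1 /= eqxx scale1r.
  by rewrite inE /= => /negbTE->.
exists (fun i => freemod_coord R i \o g) => n.
have [s us hs] := freemod_support (g n); exists s => s' us' ss'.
rewrite -[LHS]gE (FE _ s') // => i hi; apply: hs.
by apply: contra hi => /ss'.
Qed.

(** Projective modules are flat: the dual basis reduces a cycle of P (x) N to its coordinates in P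
    (x) R = P, where exactness of the resolution applies, and the lifts are reassembled. *)
Lemma projective_level (R : pzRingType) (N : lmodType R) :
  mod_projective N -> mod_level N.
Proof.
move=> /dual_basis[h hE] M _ P t; split=> [t0|[u <-]]; last first.
  rewrite tmap_comp; apply: tmap0l => x; apply/mres_exact; by exists x.
have lv i : linear (fun r : R^o => (r : R) *: i : N).
  by move=> a x y; rewrite scalerDl scalerA.
pose v i : {linear R^o -> N} := mklin (lv i).
(* The identity of B (x) N is a locally finite sum of composites through B (x) R, one for each
   member of the dual basis. *)
have tE (B : lmodType R^c) (x : tens B N) : exists s : seq N,
    forall s' : seq N, uniq s' -> {subset s <= s'} ->
    x = \sum_(i <- s') tmap idfun (v i) (tmap idfun (h i) x).
  elim/tens_ind: x => [m n|x y [s hs] [s' hs']].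
    have [s hs] := hE n; exists s => s' us' ss'.
    rewrite {1}(hs _ us' ss'); under [RHS]eq_bigr do rewrite !tmap_pure /=.
    elim: (s') => [|a r IH]; rewrite ?big_nil ?tpure0r //.
    by rewrite !big_cons tpureDr IH.
  exists (s ++ s') => r ur rs; rewrite {1}(hs r) 1?{1}(hs' r) //.
  - rewrite -sumrB; apply: eq_bigr => i _.
    by rewrite -[LHS]raddfB -[in LHS]raddfB.
  - by move=> i si; apply: rs; rewrite mem_cat si orbT.
  - by move=> i si; apply: rs; rewrite mem_cat si.
(* The map b |-> b (x) 1 is an isomorphism from B to B (x) R: [pure] is its surjectivity, [pure0]
   its injectivity. *)
pose one : (R^o : lmodType R) := (1 : R).
have pure (B : lmodType R^c) (x : tens B R^o) : exists b, x = tpure b one.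
  elim/tens_ind: x => [m r|x y [b ->] [c ->]].
    exists ((r : R^c) *: m); rewrite tpureZ; congr tpure.
    exact: (esym (mulr1 (r : R))).
  exists (b - c); have := tpureDl (b - c) c one; rewrite subrK => ->.
  by rewrite addrK.
have pure0 (B : lmodType R^c) (b : B) : tpure b one = 0 -> b = 0.
  pose f (m : B) (r : R^o) : B := (r : R^c) *: m.
  have fDl m m' n : f (m + m') n = f m n + f m' n by exact: scalerDr.
  have fDr m n n' : f m (n + n') = f m n + f m n' by exact: scalerDl.
  have fZ (r : R) m (n : R^o) : f ((r : R^c) *: m) n = f m (r *: n).
    by rewrite /f scalerA.
  by move=> /(congr1 (tens_lift fDl fDr fZ)); rewrite tens_lift_pure raddf0 /f scale1r.
have lift i : exists u : tens (P 2) R^o,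
    tmap (mres_d P 1) idfun u = tmap idfun (h i) t.
  have [b bE] := pure _ (tmap idfun (h i) t).
  have : mres_d P 0 b = 0.
    apply: pure0; rewrite -(tmap_pure (mres_d P 0) (idfun : {linear R^o -> R^o})).
    by rewrite -bE tmap_exchange t0 raddf0.
  by move=> /mres_exact[a aE]; exists (tpure a one); rewrite tmap_pure aE bE.
have /(_ _)/cid-u := lift.
have [s hs] := tE _ t; exists (\sum_(i <- undup s) tmap idfun (v i) (sval (u i))).
rewrite [RHS](hs (undup s)) ?undup_uniq // => [|i]; last by rewrite mem_undup.
by rewrite raddf_sum; apply: eq_bigr => i _; rewrite [LHS]tmap_exchange (svalP (u i)).
Qed.

(** * Extension by zero and componentwise lifting in direct sums *)

Section DirectSumTools.
Variables (I J : eqType) (V W : I -> zmodType).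

Lemma dsumBE (x y : dsum V) i : dsum_fun (x - y) i = dsum_fun x i - dsum_fun y i.
Proof. by []. Qed.

Lemma dsum_push (u : J -> I) (z : dsum (fun j => V (u j))) : injective u ->
  exists w : dsum V, (forall j, dsum_fun w (u j) = dsum_fun z j)
    /\ forall i, (forall j, u j <> i) -> dsum_fun w i = 0.
Proof.
move=> uinj.
(* The equation u j = i is only propositional, hence the transport of z_j into V_i. *)
have wP i : exists x : V i, (forall j (e : u j = i),
    x = eq_rect _ (fun k => V k : Type) (dsum_fun z j) _ e)
    /\ ((forall j, u j <> i) -> x = 0).
  have [[j <-]|nj] := pselect (exists j, u j = i).
    exists (dsum_fun z j); split=> [k e|/(_ j)//].
    have kj := uinj _ _ e; subst k.
    by rewrite (Prop_irrelevance e erefl).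
  exists 0; split=> // j e; by case: nj; exists j.
have /(_ _)/cid-w := wP.
have wf : (fun i => sval (w i)) \in @finsupp I V.
  have /asboolP[s hs] := dsum_finsupp z; apply/asboolP.
  exists (map u s) => i iu; have [[j ji]|nj] := pselect (exists j, u j = i).
    subst i; rewrite ((svalP (w _)).1 j erefl) /= hs //.
    by apply: contra iu => /(map_f u).
  by apply: (svalP (w i)).2 => j ji; apply: nj; exists j.
exists (DSum wf); split=> [j|i]; first exact: ((svalP (w (u j))).1 j erefl).
exact: (svalP (w i)).2.
Qed.

Lemma dsum_lift (phi : forall i, {additive V i -> W i}) (z : dsum W) :
  (forall i, exists x, phi i x = dsum_fun z i) ->
  exists w : dsum V, forall i, phi i (dsum_fun w i) = dsum_fun z i.
Proof.
move=> phiz.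
(* Zero is chosen over every zero component, so that the lift again has finite support. *)
have /(_ _)/cid-w i : exists x, phi i x = dsum_fun z i
    /\ (dsum_fun z i = 0 -> x = 0).
  have [z0|z0] := pselect (dsum_fun z i = 0); first by exists 0; rewrite raddf0.
  by have [x xE] := phiz i; exists x.
have wf : (fun i => sval (w i)) \in @finsupp I V.
  have /asboolP[s hs] := dsum_finsupp z; apply/asboolP.
  by exists s => i /hs; apply: (svalP (w i)).2.
by exists (DSum wf) => i; apply: (svalP (w i)).1.
Qed.

End DirectSumTools.

(** * The modified tensor product with a sum of disks *)

Section ModifiedTensor.
Variable R : pzRingType.

Lemma tensC_mapE (X X' : chcomplex R^c) (f : chmap X X') (Y : chcomplex R) n
    (z : tensC X Y n) p :
  dsum_fun (tensC_map f Y n z) p = tmap (f (val p).1) idfun (dsum_fun z p).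
Proof. by []. Qed.

Lemma ad_tensC (X : chcomplex R^c) (Y : chcomplex R) n m (e : n = m + 1)
    (z : tensC X Y n) p :
  dsum_fun (ad (tensC X Y) e z : tens_obj X Y m) p =
    tmap (cd X erefl) idfun (dsum_fun z (tens_l e p))
    + tmap idfun (cd Y erefl) (dsum_fun z (tens_r e p)) *~ sgn (val p).1.
Proof. by []. Qed.

Lemma boundaryP (C : abcomplex) n x :
  reflect (exists m (e : m = n + 1) y, ad C e y = x) (x \in @boundary C n).
Proof.
apply: (iffP (asboolP _)) => [[y yE]|[m [e [y yE]]]].
  by exists (n + 1), erefl, y.
by subst m; exists y.
Qed.

Definition mtens_class (X : chcomplex R^c) (Y : chcomplex R) n :
    {additive tensC X Y n -> mtensC X Y n} :=
  \pi_(Quotient.quot (@boundary (tensC X Y) n)).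

Arguments mtens_class {X Y n}.

Lemma mtens_class_eq0 (X : chcomplex R^c) (Y : chcomplex R) n (z : tensC X Y n) :
  (mtens_class z == 0) = (z \in @boundary (tensC X Y) n).
Proof. exact: pi_quot_eq0. Qed.

Lemma mtens_class_repr (X : chcomplex R^c) (Y : chcomplex R) n (q : mtensC X Y n) :
  exists z, mtens_class z = q.
Proof. by exists (repr q); exact: reprK. Qed.

Lemma mtensC_mapE (X X' : chcomplex R^c) (f : chmap X X') (Y : chcomplex R) n z :
  mtensC_map f Y n (mtens_class z) = mtens_class (tensC_map f Y n z).
Proof. exact: quot_map_pi. Qed.

Lemma mtens_exactP (X2 X1 X0 : chcomplex R^c) (f : chmap X2 X1) (g : chmap X1 X0)
    (Y : chcomplex R) n : (forall m x, g m (f m x) = 0) ->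
  exact_at (mtensC_map f Y n) (mtensC_map g Y n) <->
  forall z, tensC_map g Y n z \in @boundary (tensC X0 Y) n ->
    exists w, z - tensC_map f Y n w \in @boundary (tensC X1 Y) n.
Proof.
move=> gf; split=> [ex z zb|ex q].
  have [|q qE] := (ex (mtens_class z)).1.
    by rewrite mtensC_mapE; apply/eqP; rewrite mtens_class_eq0.
  have [w wq] := mtens_class_repr q; exists w.
  by rewrite -mtens_class_eq0 raddfB -mtensC_mapE wq qE subrr.
split=> [|[w' <-]].
  have [z <-] := mtens_class_repr q; rewrite mtensC_mapE => /eqP.
  rewrite mtens_class_eq0 => /ex[w]; rewrite -mtens_class_eq0 raddfB subr_eq0.
  by exists (mtens_class w); rewrite mtensC_mapE; apply/eqP; rewrite eq_sym.
have [w <-] := mtens_class_repr w'.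
rewrite !mtensC_mapE (_ : tensC_map g _ _ _ = 0) ?raddf0 //.
apply: dsum_ext => p; rewrite !tensC_mapE tmap_comp.
by apply: tmap0l => x; exact: gf.
Qed.

Section DiskRight.
Variable M : int -> lmodType R.

(* The modified tensor product of X and disk M is in degree m + 1 the direct
   sum of the X_i (x) M_(j+1) with i + j = m. *)
Section Psi.
Variables (X : chcomplex R^c) (n m : int) (e : n = m + 1).

Definition disk_tens : zmodType :=
  dsum (fun p : tpairs m => tens (X (val p).1) (M ((val p).2 + 1))).

(** The boundary of x (x) (b, 0) is dx (x) (b, 0) + (-1)^|x| x (x) (0, b), so for |x| = i + 1 the
    class of x (x) (0, b) is that of (-1)^i dx (x) (b, 0); this explains the second summand. *)
Definition disk_quot : {additive tensC X (disk M) n -> disk_tens} :=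
  dsum_map (@tens_r_inj n m e) (fun p => tmap idfun (fstl (M ((val p).2 + 1)) _)
      : {additive tens (X (val p).1) (disk M ((val p).2 + 1)%R) -> _})
  \+ dsum_map (@tens_l_inj n m e)
       (fun p => sgn_map (val p).1
         (tmap (cd X (erefl ((val p).1 + 1))) (sndl (M (val p).2) _))
         : {additive tens (X ((val p).1 + 1)%R) (disk M (val p).2) -> _}).

Lemma disk_quotE z p :
  dsum_fun (disk_quot z) p =
  tmap idfun (fstl (M ((val p).2 + 1)) _) (dsum_fun z (tens_r e p))
  + tmap (cd X (erefl ((val p).1 + 1))) (sndl (M (val p).2) _)
      (dsum_fun z (tens_l e p)) *~ sgn (val p).1.
Proof. by []. Qed.

Lemma tens_lr n' (e1 : n' = n + 1) (y : tens_obj X (disk M) n') p :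
  dsum_fun y (tens_l e1 (tens_r e p)) = dsum_fun y (tens_r e1 (tens_l e p)).
Proof. exact: tens_irr. Qed.

Lemma disk_quot_boundary z : z \in @boundary (tensC X (disk M)) n -> disk_quot z = 0.
Proof.
move=> /asboolP[y <-]; apply: dsum_ext => p.
rewrite disk_quotE !ad_tensC !raddfD !raddfMz !tmap_comp tens_lr.
rewrite [X in _ + X *~ _ + _]tmap0r // mul0rz addr0.
rewrite [X in _ + (X + _) *~ _]tmap0l; last by move=> x; exact: cd_cd.
rewrite add0r -mulrzA /= sgnS mulNr.
have -> : sgn (val p).1 * sgn (val p).1 = 1 by case: (sgnP (val p).1) => ->.
rewrite mulrNz mulr1z; apply/eqP; rewrite subr_eq0; apply/eqP; exact: eq_tmap.
Qed.

Lemma disk_quot_ker z : disk_quot z = 0 -> z \in @boundary (tensC X (disk M)) n.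
Proof.
move=> z0; apply/boundaryP.
pose in1 k : {linear M k -> disk M k} := pairl idfun \0.
(* The bounding element replaces each x (x) (a, b) by (-1)^|x| x (x) (b, 0). Its boundary has the
   bottom part of z, and the top parts agree because [disk_quot] vanishes on z. *)
pose phi (q : tpairs n) : {additive tens (X (val q).1) (disk M (val q).2) ->
    tens (X (val q).1) (disk M ((val q).2 + 1)%R)} :=
  sgn_map (val q).1 (tmap idfun (in1 _ \o sndl (M (val q).2) _)).
have [y [yE _]] := dsum_push (V := fun q : tpairs (n + 1) =>
    tens (X (val q).1) (disk M (val q).2)) (u := @tens_r (n + 1) n erefl)
  (dsum_map (@inj_id (tpairs n)) phi z) (@tens_r_inj (n + 1) n erefl).
have yE' q : dsum_fun y (tens_r erefl q) =
    tmap idfun (in1 _ \o sndl (M (val q).2) _) (dsum_fun z q) *~ sgn (val q).1.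
  by rewrite yE.
exists (n + 1), erefl, y; apply: dsum_ext => q.
have [p pE] : exists p, q = tens_r e p.
  case: q => -[i j] h; have h' : i + (j - 1) == m.
    by rewrite addrA (eqP h : i + j = n) e addrK.
  by exists (exist _ (i, j - 1) h'); apply: val_inj; rewrite /= subrK.
subst q; rewrite ad_tensC tens_lr !yE'.
set zr := dsum_fun z (tens_r e p); set zl := dsum_fun z (tens_l e p).
have zE : tmap (cd X erefl) (sndl (M (val p).2) _) zl *~ sgn ((val p).1 + 1)
    = tmap idfun (fstl _ _) zr.
  have := congr1 (fun w : disk_tens => dsum_fun w p) z0.
  rewrite disk_quotE sgnS mulrNz => /eqP.
  by rewrite addr_eq0 => /eqP->.
have ss a : sgn a * sgn a = 1 by case: (sgnP a) => ->.
rewrite [X in X + _](_ : _ = tmap idfun (in1 _) (tmap idfun (fstl _ _) zr)).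
  rewrite [X in _ + X](_ : _ = tmap idfun (cd (disk M) erefl)
      (tmap idfun (in1 _) (tmap idfun (sndl _ _) zr))).
    rewrite !tmap_comp -[RHS]tmap_id; apply/esym; apply: tmapDr => -[x x'].
    by apply: injective_projections; rewrite /= ?addr0 ?add0r.
  rewrite raddfMz -mulrzA ss mulr1z !tmap_comp; exact: eq_tmap.
by rewrite -zE !raddfMz !tmap_comp; congr (_ *~ _); apply: eq_tmap.
Qed.



Lemma disk_quot_section (w : disk_tens) : exists z,
  (forall p, dsum_fun z (tens_r e p) = tmap idfun (pairl idfun \0) (dsum_fun w p))
  /\ disk_quot z = w.
Proof.
pose in1 k : {linear M k -> disk M k} := pairl idfun \0.
pose phi (p : tpairs m) : {additive tens (X (val p).1) (M ((val p).2 + 1)%R) ->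
    tens (X (val p).1) (disk M ((val p).2 + 1)%R)} := tmap idfun (in1 _).
have [z [zE _]] := dsum_push (V := fun q : tpairs n =>
    tens (X (val q).1) (disk M (val q).2)) (u := @tens_r n m e)
  (dsum_map (@inj_id (tpairs m)) phi w) (@tens_r_inj n m e).
have zE' p : dsum_fun z (tens_r e p) = tmap idfun (in1 _) (dsum_fun w p) by rewrite zE.
exists z; split=> //; apply: dsum_ext => p.
have [p' p'E] : exists p', tens_l e p = tens_r e p'.
  case: p => -[i j] h; have h' : i + 1 + (j - 1) == m.
    by rewrite addrACA subrr addr0.
  by exists (exist _ (i + 1, j - 1) h'); apply: val_inj; rewrite /= subrK.
rewrite disk_quotE zE'.
(* The chosen representative has no bottom part, so the second summand of [disk_quot] vanishes on
   it. *)
have -> : tmap (cd X (erefl ((val p).1 + 1))) (sndl (M (val p).2) _)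
    (dsum_fun z (tens_l e p)) = 0.
  have := zE' p'.
  case: p p'E => -[i j] h; case: p' => -[i' j'] h' pp.
  have [? ?] : i + 1 = i' /\ j = j' + 1 by case/(congr1 val): pp.
  subst i' j => zp.
  have -> : dsum_fun z (tens_l e (exist _ (i, j' + 1) h))
      = dsum_fun z (tens_r e (exist _ (i + 1, j') h')) by exact: tens_irr.
  by rewrite zp [LHS]tmap_comp; apply: tmap0r.
by rewrite mul0rz addr0 tmap_comp -[RHS]tmap_id; apply: eq_tmap.
Qed.

End Psi.

Lemma disk_quot_map (X X' : chcomplex R^c) (f : chmap X X') n m (e : n = m + 1) z p :
  dsum_fun (disk_quot X' e (tensC_map f _ n z)) p
  = tmap (f (val p).1) idfun (dsum_fun (disk_quot X e z) p).
Proof.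
rewrite !disk_quotE !tensC_mapE raddfD raddfMz !tmap_comp.
by congr (_ + _ *~ _); apply: eq_tmap => x //=; rewrite cmap_comm.
Qed.

(** Through the natural isomorphism induced by [disk_quot], the sequence is the direct sum over i +
    j = n - 1 of the sequences in X_i (x) M_(j+1). *)
Lemma disk_mTor1 (X2 X1 X0 : chcomplex R^c) (f : chmap X2 X1) (g : chmap X1 X0) n :
  (forall m x, g m (f m x) = 0) ->
  (forall i j, exact_at (tmap (f i) (idfun : {linear M j -> M j}))
                        (tmap (g i) (idfun : {linear M j -> M j}))) ->
  exact_at (mtensC_map f (disk M) n) (mtensC_map g (disk M) n).
Proof.
move=> gf fg; apply/(mtens_exactP _ _ gf) => z zb.
have e := int_pred n.
have z0 p : tmap (g (val p).1) idfun (dsum_fun (disk_quot X1 e z) p) = 0.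
  by rewrite -disk_quot_map disk_quot_boundary.
have /dsum_lift[w wE] p : exists x : tens (X2 (val p).1) (M ((val p).2 + 1)),
    tmap (f (val p).1) idfun x = dsum_fun (disk_quot X1 e z) p.
  exact: (fg _ _ _).1 (z0 p).
have [v [_ vE]] := disk_quot_section e w.
exists v; apply: (@disk_quot_ker _ _ _ e); apply: dsum_ext => p.
by rewrite raddfB dsumBE disk_quot_map vE wE subrr.
Qed.

End DiskRight.
End ModifiedTensor.

(** * Resolutions of components and of disks *)

Section Resolutions.
Variable R : pzRingType.

Definition cobj_resolution (X : chcomplex R) (P : ch_resolution X) i :
    mod_resolution (X i) :=
  @ModResolution R (X i) (fun n => P n i) (fun n => cres_d P n i) (cres_aug P i)
    (fun n => @projective_cobj R (P n) i (@cres_projective _ _ P n))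
    (@cres_aug_surj _ _ P i) (@cres_exact0 _ _ P i) (fun n => @cres_exact _ _ P n i).

Section DiskMap.
Variables (M N : int -> lmodType R) (f : forall n, {linear M n -> N n}).

Fact disk_map_comm i j (e : i = j + 1) x :
  mapl (f j) (f (j + 1)) (cd (disk M) e x)
  = cd (disk N) e (mapl (f i) (f (i + 1)) x).
Proof. by subst i; apply: injective_projections; rewrite /= ?linear0. Qed.

Definition disk_map : chmap (disk M) (disk N) := 
  @ChMap R (disk M) (disk N) (fun i => mapl (f i) (f (i + 1))) disk_map_comm.

End DiskMap.

Section DiskResolution.
Variables (M : int -> lmodType R) (P : forall i, mod_resolution (M i)).

Let PP n : chcomplex R := disk (fun i => P i n).

Fact disk_res_exact n i : exact_at
  (disk_map (fun i => mres_d (P i) n.+1) i) (disk_map (fun i => mres_d (P i) n) i).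
Proof.
move=> [x y]; split=> [[/mres_exact[x' <-] /mres_exact[y' <-]]|[[x' y'] [<- <-]]].
  by exists (x', y').
by apply: injective_projections; apply/mres_exact; [exists x' | exists y'].
Qed.

Fact disk_res_exact0 i : exact_at
  (disk_map (fun i => mres_d (P i) 0) i) (disk_map (fun i => mres_aug (P i)) i).
Proof.
move=> [x y]; split=> [[/mres_exact0[x' <-] /mres_exact0[y' <-]]|[[x' y'] [<- <-]]].
  by exists (x', y').
by apply: injective_projections; apply/mres_exact0; [exists x' | exists y'].
Qed.

Fact disk_res_surj i : surj (disk_map (fun i => mres_aug (P i)) i).
Proof.
move=> [x y]; have [x' <-] := @mres_aug_surj _ _ (P i) x.
by have [y' <-] := @mres_aug_surj _ _ (P (i + 1)) y; exists (x', y').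
Qed.

Definition disk_resolution : ch_resolution (disk M) :=
  @ChResolution R (disk M) PP (fun n => disk_map (fun i => mres_d (P i) n))
    (disk_map (fun i => mres_aug (P i)))
    (fun n => disk_projective (fun i => @mres_projective _ _ (P i) n))
    disk_res_surj disk_res_exact0 disk_res_exact.

End DiskResolution.

Lemma mod_fg_prod (M N : lmodType R) :
  mod_fg M -> mod_fg N -> mod_fg (M * N)%type.
Proof.
move=> [m [v vE]] [n [w wE]]; exists (m + n)%N.
exists (fun i => match split i with inl j => (v j, 0) | inr j => (0, w j) end).
move=> [x y]; have [c ->] := vE x; have [d ->] := wE y.
exists (fun i => match split i with inl j => c j | inr j => d j end).
rewrite big_split_ord /=.
under [X in _ = X + _]eq_bigr => i _ do rewrite (unsplitK (inl _ i : 'I_m + 'I_n)).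
under [X in _ = _ + X]eq_bigr => i _ do rewrite (unsplitK (inr _ i : 'I_m + 'I_n)).
have -> : \sum_i c i *: (v i, 0 : N) = pairl idfun \0 (\sum_i c i *: v i).
  by rewrite linear_sum; apply: eq_bigr => i _; rewrite linearZ.
have -> : \sum_i d i *: (0 : M, w i) = pairl \0 idfun (\sum_i d i *: w i).
  by rewrite linear_sum; apply: eq_bigr => i _; rewrite linearZ.
by apply: injective_projections; rewrite /= ?addr0 ?add0r.
Qed.

Definition mod0 : lmodType R := 'rV[R]_0.

Lemma mod0_eq (x y : mod0) : x = y.
Proof. by rewrite [x]thinmx0 [y]thinmx0. Qed.

Lemma mod0_fg : mod_fg mod0.
Proof. by exists 0%N, (fun _ => 0) => x; exists (fun _ => 0); exact: mod0_eq. Qed.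

Definition mod0_resolution : mod_resolution mod0.
Proof.
refine (@ModResolution R mod0 (fun _ => mod0) (fun _ => \0) \0 _ _ _ _) => //.
- by move=> n M N g f gs; exists \0 => x; rewrite (mod0_eq x 0) !linear0.
- by move=> y; exists 0; exact: mod0_eq.
- by move=> y; split=> _; [exists 0|]; exact: mod0_eq.
- by move=> n y; split=> _; [exists 0|]; exact: mod0_eq.
Defined.

Definition at0 (M : lmodType R) (i : int) : lmodType R :=
  if i is Posz 0 then M else mod0.

Definition at0_resolution (M : lmodType R) (P : mod_resolution M) i :
    mod_resolution (at0 M i) :=
  match i with Posz 0 => P | Posz _.+1 | Negz _ => mod0_resolution end.

Lemma FPinfty_disk (M : lmodType R) : mod_FPinfty M -> ch_FPinfty (disk (at0 M)).
Proof.
move=> [P Pfg]; exists (disk_resolution (at0_resolution P)) => n.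
have H i : i != 0 -> forall x : at0_resolution P i n, x = 0.
  by case: i => [[|i]|i] // _ x; exact: mod0_eq.
split=> [|i]; last first.
  have A j : mod_fg (at0_resolution P j n).
    by case: j => [[|j]|j] /=; [exact: Pfg | exact: mod0_fg | exact: mod0_fg].
  by apply: mod_fg_prod; exact: A.
(* A disk on a family concentrated in degree 0 lives in degrees 0 and -1. *)
exists 1%N => i i1 [x y]; apply: injective_projections; apply: H.
  by apply: contraTneq i1 => ->.
by apply: contraTneq i1 => /eqP; rewrite addr_eq0 => /eqP->.
Qed.

End Resolutions.

(** * Level complexes: sums of disks, components and shifts *)

Section Level.
Variable R : pzRingType.

(** Against a sum of disks the modified Tor is computed by Tor of the components, and the components
    of a complex of type FP_infinity are of type FP_infinity. *)
Lemma level_disk (M : int -> lmodType R) :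
  (forall j, mod_level (M j)) -> ch_level (disk M).
Proof.
move=> Ml X [Q Qfg] P n; apply: disk_mTor1 => [m x|i j].
  by apply/cres_exact; exists x.
apply: (Ml j (X i) _ (cobj_resolution P i)); exists (cobj_resolution Q i) => k.
exact: (Qfg k).2.
Qed.

(* The difference of the two sides induces the isomorphism of the modified tensor
   product of disk M and Y with the sum of the M_(i+1) (x) Y_j. *)
Lemma disk_left_boundary (M : int -> lmodType R^c) (Y : chcomplex R) (n i j : int)
    (h : i + 1 + j == n) (h' : i + (j + 1) == n) z :
  z \in @boundary (tensC (disk M) Y) n ->
  tmap (fstl _ _) idfun (dsum_fun z (exist _ (i + 1, j) h)) =
  tmap (sndl _ _) (cd Y (erefl (j + 1))) (dsum_fun z (exist _ (i, j + 1) h'))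
    *~ sgn (i + 1).
Proof.
move=> /boundaryP[m [e [y <-]]]; rewrite !ad_tensC !raddfD !raddfMz !tmap_comp.
rewrite [X in X + _ = _]tmap0l // add0r.
rewrite [X in _ = (_ + X *~ _) *~ _]tmap0r; last by move=> x; exact: cd_cd.
rewrite mul0rz addr0; congr (_ *~ _).
have -> : dsum_fun y (tens_l e (exist _ (i, j + 1) h'))
    = dsum_fun y (tens_r e (exist _ (i + 1, j) h)) by exact: tens_irr.
exact: eq_tmap.
Qed.

Lemma dsum_in (I : eqType) (V : I -> zmodType) i (x : V i) :
  exists w : dsum V, dsum_fun w i = x /\ forall j, j != i -> dsum_fun w j = 0.
Proof.
have f : (fun _ : unit => x) \in @finsupp unit (fun=> V i).
  by apply/asboolP; exists [:: tt] => -[].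
have [|w [wi w0]] := @dsum_push I unit V (fun=> i) (DSum f); first by case=> [[]].
by exists w; split=> [|j /eqP ji]; [exact: (wi tt) | apply: w0 => _ /esym].
Qed.

(** [L] is tested against the disk on [A] in degrees 0 and -1, which is again of type FP_infinity:
    in degree j, the modified tensor product of L with the disk on P_n is P_n (x) L_j. *)
Lemma level_cobj (L : chcomplex R) j : ch_level L -> mod_level (L j).
Proof.
move=> Ll A Afp P.
pose X n := disk (fun i => at0_resolution P i n).
have PP (k : nat) (x : P k.+2) : mres_d P k (mres_d P k.+1 x) = 0.
  by apply/mres_exact; exists x.
move=> t; split=> [t0|[w <-]]; last first.
  by rewrite tmap_comp; apply: tmap0l => x; exact: PP.
(* Degree 0 is written -1 + 1 to match the indices of [disk_left_boundary]. *)
have h : -1 + 1 + j == j :> int by rewrite addNr add0r.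
have h' : -1 + (j + 1) == j :> int by rewrite addrCA addNr addr0.
have gf m x : cres_d (disk_resolution (at0_resolution P)) 0 m
    (cres_d (disk_resolution (at0_resolution P)) 1 m x) = 0.
  by apply/cres_exact; exists x.
have /(mtens_exactP _ _ gf)ex := Ll _ (FPinfty_disk Afp)
  (disk_resolution (at0_resolution P)) j.
pose in1 n : {linear P n -> X n (-1 + 1)} := pairl idfun \0.
(* [z] is t placed in the top component in bidegree (0, j), and zero elsewhere. *)
have [z [zE z0]] := dsum_in
  (V := fun p : tpairs j => tens (X 1%N (val p).1) (L (val p).2))
  (i := exist _ (-1 + 1, j) h) (tmap (in1 1%N) idfun t).
have [|w /(disk_left_boundary h h')] := ex z.
  rewrite (_ : tensC_map _ _ _ _ = 0) ?rpred0 //; apply: dsum_ext => p.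
  rewrite tensC_mapE; have [->|/z0->] := eqVneq p (exist _ (-1 + 1, j) h);
    last exact: raddf0.
  rewrite zE [LHS]tmap_comp.
  have -> : tmap (cres_d (disk_resolution (at0_resolution P)) 0 (-1 + 1) \o in1 1%N)
    (idfun \o idfun) t = tmap (in1 0%N) idfun (tmap (mres_d P 0) idfun t).
    by rewrite tmap_comp; apply: eq_tmap => x //; apply: injective_projections;
      rewrite //= linear0.
  by rewrite t0 raddf0.
set wa := dsum_fun w (exist _ (-1 + 1, j) h).
set wb := dsum_fun w (exist _ (-1, j + 1) h').
pose p1 n : {linear X n (-1 + 1) -> P n} := fstl _ _.
pose p2 n : {linear X n (-1) -> P n} := sndl _ _.
rewrite !dsumBE !tensC_mapE -/wa -/wb zE z0; last first.
  by apply/eqP => /(congr1 val)[].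
rewrite sub0r !raddfB raddfN => E.
have E1 : tmap (p1 1%N) (idfun : {linear L j -> L j}) (tmap (in1 1%N) idfun t) = t.
  by rewrite tmap_comp -[RHS]tmap_id; apply: eq_tmap.
move/eqP: E; rewrite subr_eq => /eqP E.
(* This is the value on [w] of the isomorphism onto P_2 (x) L_j; [E] says that its image is t. *)
exists (tmap (p1 2%N) idfun wa - tmap (p2 2%N) (cd L erefl) wb *~ sgn (-1 + 1)).
rewrite raddfB raddfMz -[RHS]E1 [RHS]E [RHS]addrC ?mulNrz.
by congr (_ - _ *~ _); rewrite [LHS]tmap_comp [RHS]tmap_comp; apply: eq_tmap.
Qed.

(* The differential of shift k L carries no sign, so that X (x) shift k L is
   X (x) L with its degrees lowered by k. *)
Section Shift.
Variables (k : int) (L : chcomplex R).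

Fact shift_pair_subproof n n' (e : n' = n + k) (p : tpairs n) :
  (val p).1 + ((val p).2 + k) == n'.
Proof. by case: p => -[i j] /= /eqP h; rewrite e -h addrA. Qed.
Definition shift_pair n n' (e : n' = n + k) (p : tpairs n) : tpairs n' :=
  exist _ ((val p).1, (val p).2 + k) (shift_pair_subproof e p).

Lemma shift_pair_inj n n' (e : n' = n + k) : injective (shift_pair e).
Proof.
move=> [[i j] h] [[i' j'] h'] /(congr1 val) /= [ii' /addIr jj'].
by apply: val_inj; rewrite /= ii' jj'.
Qed.

Lemma shift_pair_surj n n' (e : n' = n + k) q : exists p, shift_pair e p = q.
Proof.
case: q => -[i j] h; have h' : i + (j - k) == n.
  by rewrite addrA (eqP h : i + j = n') e addrK.
by exists (exist _ (i, j - k) h'); apply: val_inj; rewrite /= subrK.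
Qed.

Variable X : chcomplex R^c.

Definition tens_shift n n' (e : n' = n + k) :
    {additive tensC X L n' -> tensC X (shift k L) n} :=
  dsum_map (@shift_pair_inj n n' e) (fun p =>
    idfun : {additive tens (X (val p).1) (L ((val p).2 + k)%R) -> _}).

Lemma tens_shiftE n n' (e : n' = n + k) z p :
  dsum_fun (tens_shift e z) p = dsum_fun z (shift_pair e p).
Proof. by []. Qed.

Lemma tens_shift_inj n n' (e : n' = n + k) : injective (tens_shift e).
Proof.
move=> x y xy; apply: dsum_ext => q; have [p <-] := shift_pair_surj e q.
by rewrite -!tens_shiftE xy.
Qed.

Lemma tens_shift_surj n n' (e : n' = n + k) : surj (tens_shift e).
Proof.
move=> y; have [w [wE _]] := dsum_push (V := fun p : tpairs n' =>
  tens (X (val p).1) (L (val p).2)) (u := @shift_pair n n' e) y (@shift_pair_inj n n' e).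
by exists w; apply: dsum_ext => p; exact: wE.
Qed.

Lemma tens_shift_d n n' m m' (e : n' = n + k) (e' : m' = m + k)
    (d : n = m + 1) (d' : n' = m' + 1) z :
  tens_shift e' (ad (tensC X L) d' z) = ad (tensC X (shift k L)) d (tens_shift e z).
Proof.
apply: dsum_ext => p; rewrite tens_shiftE !ad_tensC !tens_shiftE.
congr (_ + _ *~ _); first by congr (tmap _ _ _); exact: tens_irr.
case: p => -[i j] h /=.
(* The degrees j + 1 + k and j + k + 1 of [L] agree only propositionally, so the claim is
   generalised over both before they are identified. *)
have D j1 j2 (ej : j2 = j1) (h1 : i + j1 == n') (h2 : i + j2 == n')
   (d1 : j1 = j + k + 1) (d2 : j2 = j + k + 1) :
   tmap (idfun : {linear X i -> X i}) (cd L d1) (dsum_fun z (exist _ (i, j1) h1))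
   = tmap idfun (cd L d2) (dsum_fun z (exist _ (i, j2) h2)).
  subst j2; rewrite (Prop_irrelevance d1 d2); congr (tmap _ _ _); exact: tens_irr.
exact: D (addrAC _ _ _) _ _ _ _.
Qed.

Lemma tens_shift_boundary n n' (e : n' = n + k) z :
  (tens_shift e z \in @boundary (tensC X (shift k L)) n)
  = (z \in @boundary (tensC X L) n').
Proof.
have en : n' + 1 = n + 1 + k by rewrite e addrAC.
apply/boundaryP/boundaryP => [[m [d [y yE]]]|[m [d [y yE]]]].
  subst m; have [y' y'E] := tens_shift_surj en y.
  exists (n' + 1), erefl, y'; apply: (@tens_shift_inj n n' e).
  by rewrite (tens_shift_d en e erefl erefl) y'E.
subst m; exists (n + 1), erefl, (tens_shift en y).
by rewrite -(tens_shift_d en e erefl erefl) yE.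
Qed.

End Shift.

Lemma tens_shift_map k (L : chcomplex R) (X X' : chcomplex R^c) (f : chmap X X')
    n n' (e : n' = n + k) z :
  tensC_map f (shift k L) n (tens_shift L X e z) = tens_shift L X' e (tensC_map f L n' z).
Proof. by apply: dsum_ext. Qed.

Lemma level_shift k (L : chcomplex R) : ch_level L -> ch_level (shift k L).
Proof.
move=> Ll X Xfp P n.
have gf m x : cres_d P 0 m (cres_d P 1 m x) = 0 by apply/cres_exact; exists x.
have ex := (mtens_exactP L (n + k) gf).1 (Ll X Xfp P (n + k)).
apply/(mtens_exactP _ _ gf) => y.
have [z <-] := tens_shift_surj (erefl (n + k)) y.
rewrite tens_shift_map tens_shift_boundary => /ex[w wb].
exists (tens_shift L _ erefl w).
by rewrite tens_shift_map -raddfB tens_shift_boundary.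
Qed.

End Level.

(** * Short exact sequences of complexes and complete resolutions *)

Section GorensteinComplexes.
Variable R : pzRingType.
Implicit Types K P X Y L C : chcomplex R.

Record ch_ses K P X (u : chmap K P) (p : chmap P X) : Prop := ChSes {
  ch_ses_projective : ch_projective P;
  ch_ses_inj : forall n, injective (u n);
  ch_ses_exact : forall n, exact_at (u n) (p n);
  ch_ses_surj : forall n, surj (p n);
  ch_ses_level : forall n, level_extends (u n) }.

Section HomOfSes.
Variables (K P X L : chcomplex R) (u : chmap K P) (p : chmap P X).
Hypothesis (up : ch_ses u p) (Ll : ch_level L).

Let P_exact : ab_exact (homC P L).
Proof. exact/homC_contractible/projective_contractible/(ch_ses_projective up). Qed.

Let u_ext n m (f : {linear K n -> L m}) :
  exists g : {linear P n -> L m}, forall x, g (u n x) = f x.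
Proof. by apply: (ch_ses_level up); apply: level_cobj. Qed.

Let a_inj := hom_pull_inj (L := L) (ch_ses_surj up).
Let ab_ex := hom_pull_exact (L := L) (ch_ses_surj up) (ch_ses_exact up).
Let b_surj := hom_pull_surj u_ext.

(** Hom(-, L) reverses the sequence: Hom(X, L) is a subcomplex of Hom(P, L) with quotient Hom(K,
    L). *)
Lemma homC_exact_sub : ab_exact (homC X L) -> ab_exact (homC K L).
Proof.
move=> XL; exact: (ab_exact_quotient (hom_pull_comm (L := L) p)
  (hom_pull_comm (L := L) u) a_inj ab_ex b_surj XL P_exact).
Qed.

Lemma homC_exact_quotient : ab_exact (homC K L) -> ab_exact (homC X L).
Proof.
exact: (ab_exact_sub (hom_pull_comm (L := L) p)
  (hom_pull_comm (L := L) u) a_inj ab_ex b_surj P_exact).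
Qed.

Lemma chmap_extends (f : chmap K L) : ab_exact (homC X L) ->
  exists g : chmap P L, forall n x, g n (u n x) = f n x.
Proof.
move=> XL; have e : 0 = -1 + 1 :> int by [].
have [phi [dphi phiE]] := chmap_cycle f e.
have [psi psiE dpsi] := lift_cycle (hom_pull_comm (L := L) p)
  (hom_pull_comm (L := L) u) a_inj ab_ex b_surj XL dphi.
have [g gE] := cycle_chmap dpsi; exists g => n x.
have h : n == n + 0 by rewrite addr0.
by rewrite -(phiE n h) -psiE -(gE n h).
Qed.

End HomOfSes.

(** The class written G in the overview; dw stands for degreewise. *)
Definition dwGACproj X : Prop :=
  (forall n, mod_GACproj (X n)) /\ (forall L, ch_level L -> ab_exact (homC X L)).

Lemma GACproj_syzygy_family (N : int -> lmodType R) : (forall n, mod_GACproj (N n)) ->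
  exists (K P : int -> lmodType R) (i : forall n, {linear K n -> P n})
      (p : forall n, {linear P n -> N n}),
    forall n, mod_ses (i n) (p n) /\ mod_GACproj (K n).
Proof.
move=> Nn; have /(_ _)/cid-K n := GACproj_syzygy (Nn n).
have /(_ _)/cid-P n := svalP (K n); have /(_ _)/cid-i n := svalP (P n).
have /(_ _)/cid-p n := svalP (i n).
exists (fun n => sval (K n)), (fun n => sval (P n)), (fun n => sval (i n)).
by exists (fun n => sval (p n)) => n; exact: svalP (p n).
Qed.

Lemma mod_ses_lcast (V : int -> lmodType R) n m (e : n = m) (P C : lmodType R)
    (i : {linear V m -> P}) (p : {linear P -> C}) :
  mod_ses i p -> mod_ses (i \o lcast V e) p.
Proof.
by subst m; case=> *; split.
Qed.

(** The cosyzygy of N_(n-1) is stored at index n, because [disk_in] expects maps X_n -> M_(n+1). *)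
Lemma GACproj_cosyzygy_family (N : int -> lmodType R) : (forall n, mod_GACproj (N n)) ->
  exists (P C : int -> lmodType R) (i : forall n, {linear N n -> P (n + 1)})
      (p : forall n, {linear P n -> C n}),
    (forall n, mod_ses (i n) (p (n + 1))) /\
    (forall n, mod_projective (P n)) /\ forall n, mod_GACproj (C n).
Proof.
move=> Nn; have /(_ _)/cid-P n := GACproj_cosyzygy (Nn (n - 1)).
have /(_ _)/cid-C n := svalP (P n); have /(_ _)/cid-i n := svalP (C n).
have /(_ _)/cid-p n := svalP (i n).
exists (fun n => sval (P n)), (fun n => sval (C n)).
exists (fun n => sval (i (n + 1)) \o lcast N (esym (addrK 1 n))), (fun n => sval (p n)).
split=> [n|]; last by split=> n; [exact: ses_projective (svalP (p n)).1 |
                                  exact: (svalP (p n)).2].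
exact: mod_ses_lcast (svalP (p (n + 1))).1.
Qed.

Lemma dwGACproj_syzygy X : dwGACproj X ->
  exists (K P : chcomplex R) (u : chmap K P) (p : chmap P X),
    ch_ses u p /\ dwGACproj K.
Proof.
move=> [Xn XL].
have [Z [Q [z [q /all_and2[zq Zn]]]]] := GACproj_syzygy_family Xn.
have zq0 n x : q n (z n x) = 0 by apply/(ses_exact (zq n)); exists x.
(* [e n] lifts d q along q, by projectivity of Q_(n+1). The kernel of [p] consists of the (x, y)
   with q x + d q y = q (x + e y) = 0, which [u] parametrises by x + e y in Z_n and y in Q_(n+1). *)
have /(_ _)/cid-e n :=
  ses_projective (zq (n + 1)) (cd X erefl \o q (n + 1)) (ses_surj (zq n)).
have eE n x : q n (sval (e n) x) = cd X erefl (q (n + 1) x) := svalP (e n) x.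
pose p := disk_out (M := Q) q.
pose u n : {linear (Z n * Q (n + 1)%R)%type -> disk Q n} :=
  
  pairl ((z n \o fstl (Z n) _) \- (sval (e n) \o sndl _ (Q (n + 1)))) (sndl _ _).
have uinj n : injective (u n).
  move=> [x y] [x' y'] [/= E yy]; subst y'; congr (_, _).
  by move/addIr: E; exact: ses_inj (zq n) _ _.
have uex n : exact_at (u n) (p n).
  move=> [x y]; rewrite disk_outE -eE -linearD.
  split=> [/(ses_exact (zq n))[w wE]|[[w y'] [<- <-]]].
    by exists (w, y); apply: injective_projections; rewrite //= wE addrK.
  by rewrite subrK zq0.
have [i j ei x|d [dd [v vE]]] := subcomplex (P := disk Q) uinj.
  by apply/uex; rewrite cmap_comm (_ : p i _ = 0) ?raddf0 //; apply/uex; exists x.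
have up : ch_ses v p.
  split=> [|n|n|n|n]; first exact: disk_projective (fun n => ses_projective (zq n)).
  - by move=> x y; rewrite !vE; apply: uinj.
  - by move=> y; rewrite uex; split=> -[x xE]; exists x; rewrite -xE vE.
  - exact: disk_out_surj (fun n => ses_surj (zq n)) n.
  move=> L Ll f; have [g gE] := ses_level (zq n) Ll (f \o pairl idfun \0).
  (* In the parameters x + e y and y, the part of f on Z_n is extended by [g] and the part on
     Q_(n+1) is kept. *)
  pose h : {linear disk Q n -> L} :=
    (g \o (fstl (Q n) (Q (n + 1)) \+ (sval (e n) \o sndl (Q n) (Q (n + 1)))))
    \+ (f \o pairl \0 (sndl (Q n) (Q (n + 1)))).
  exists h => -[w y]; rewrite vE /= subrK gE /= -linearD.
  by congr (f _); apply: injective_projections; rewrite /= ?addr0 ?add0r.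
exists (ChComplex dd), (disk Q), v, p; split=> //; split=> [n|L Ll].
  exact: GACproj_prod (Zn n) (ses_projective (zq (n + 1))).
exact: homC_exact_sub up Ll (XL L Ll).
Qed.

Lemma dwGACproj_cosyzygy X : dwGACproj X ->
  exists (P C : chcomplex R) (u : chmap X P) (p : chmap P C),
    ch_ses u p /\ dwGACproj C.
Proof.
move=> [Xn XL].
have [M [C [i [q [zq [Mp Cn]]]]]] := GACproj_cosyzygy_family Xn.
pose u := disk_in (M := M) i.
have qi0 n x : q (n + 1) (i n x) = 0 by apply/(ses_exact (zq n)); exists x.
(* M_n is projective, hence level, so the top component of [u] extends along i_n to M_(n+1).
   Subtracting the extension identifies the cokernel of u with the product of C_(n+1) and M_n. *)
have /(_ _)/cid-g n := ses_level (zq n) (projective_level (Mp n)) (fstl _ _ \o u n).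
have gE n x : sval (g n) (i n x) = (u n x).1 := svalP (g n) x.
pose p n : {linear disk M n -> (C (n + 1)%R * M n)%type} :=
  pairl (q (n + 1) \o sndl (M n) _)
    (fstl (M n) (M (n + 1)) \- (sval (g n) \o sndl (M n) _)).
have psurj n : surj (p n).
  move=> [c a]; have [b bE] := ses_surj (zq n) c.
  by exists (a + sval (g n) b, b); apply: injective_projections; rewrite //= addrK.
have uex n : exact_at (u n) (p n).
  move=> [a b]; split=> [[/(ses_exact (zq n))[x xE] /subr0_eq/= ab]|[x <-]].
    by exists x; apply: injective_projections => //; rewrite -gE xE -ab.
  by apply: injective_projections; rewrite /= ?qi0 // gE subrr.
have [k j e x /uex[y <-]|d [dd [v vE]]] := quotient_complex (P := disk M) psurj.
  by apply/uex; exists (cd X e y); rewrite cmap_comm.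
have up : ch_ses u v.
  split=> [|n|n|n|n]; first exact: disk_projective.
  - by move=> x y /(congr1 snd); exact: ses_inj (zq n) _ _.
  - by move=> y; rewrite vE; exact: uex.
  - by move=> y; have [x <-] := psurj n y; exists x; rewrite vE.
  move=> L Ll f; have [h hE] := ses_level (zq n) Ll f.
  by exists (h \o sndl (M n) _) => x; rewrite -hE.
exists (disk M), (ChComplex dd), u, v; split=> //; split=> [n|L Ll].
  exact: GACproj_prod.
exact: homC_exact_quotient up Ll (XL L Ll).
Qed.

Lemma biinfinite (T : Type) (E : T -> T -> Prop) (x : T) :
  (forall y, exists z, E z y) -> (forall y, exists z, E y z) ->
  exists Z : int -> T, Z 0 = x /\ forall i j : int, i = j + 1 -> E (Z i) (Z j).
Proof.
move=> /choice[l lE] /choice[r rE].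
exists (fun i => match i with Posz n => iter n l x | Negz n => iter n.+1 r x end).
split=> // i [n|[|n]] ->; first by rewrite addrC; exact: lE.
  exact: rE.
suff -> : Negz n.+1 + 1 = Negz n by exact: rE.
by rewrite !NegzE -[n.+2]addn1 PoszD opprD addrNK.
Qed.

Lemma dwGACproj_GACproj X : dwGACproj X -> ch_GACproj X.
Proof.
move=> Xg; pose T := {Y : chcomplex R | dwGACproj Y}.
pose E (K Y : T) :=
  exists (P : chcomplex R) (u : chmap (sval K) P) (p : chmap P (sval Y)),
  ch_ses u p.
have [|Y|Z [Z0 ZE]] := @biinfinite T E (exist _ X Xg).
- move=> [Y Yg]; have [K [P [u [p [up Kg]]]]] := dwGACproj_syzygy Yg.
  by exists (exist _ K Kg), P, u, p.
- case: Y => [Y Yg]; have [P [C [u [p [up Cg]]]]] := dwGACproj_cosyzygy Yg.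
  by exists (exist _ C Cg), P, u, p.
(* P_i must not depend on the proof of i = j + 1, so it is chosen at i - 1 before [j] is
   quantified. *)
have /(_ _)/cid-P i : exists (P : chcomplex R) (u : chmap (sval (Z i)) P),
    forall j, i = j + 1 -> exists p : chmap P (sval (Z j)), ch_ses u p.
  have [P [u [p up]]] := ZE _ _ (int_pred i); exists P, u => j e.
  have ij : i - 1 = j by rewrite e addrK.
  by subst j; exists p.
have /(_ _)/cid-u i := svalP (P i).
have /(_ _ _ _)/cid-p i j e := svalP (u i) j e.
pose d i j (e : i = j + 1) := ch_comp (sval (u j)) (sval (p i j e)).
have ses i j (e : i = j + 1) := svalP (p i j e).
(* An isomorphism from X to Z_0 replaces transport along Z 0 = X. *)
have [c cbij] : exists c : chmap X (sval (Z 0)),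
    forall n, injective (c n) /\ surj (c n).
  by rewrite Z0; exists (ch_id X) => n; split=> // x; exists x.
have d_ker i j (e : i = j + 1) n x : d i j e n x = 0 <-> sval (p i j e) n x = 0.
  rewrite /=; split=> [|->]; last exact: linear0.
  by rewrite -[RHS](linear0 (sval (u j) n)); apply: (ch_ses_inj (ses _ _ (int_pred j))).
exists (fun i => sval (P i)), d, (ch_comp (sval (u 0)) c).
split=> [i|i j k e e' n y|n|L Ll i j k e e' f].
- exact: ch_ses_projective (ses _ _ (int_pred i)).
- rewrite d_ker (ch_ses_exact (ses j k e')); split=> [[x <-]|[x <-]].
    by have [w <-] := ch_ses_surj (ses i j e) x; exists w.
  by exists (sval (p i j e) n x).
- split=> [x y /(ch_ses_inj (ses _ _ (int_pred 0)))|k e y]; first exact: (cbij n).1.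
  rewrite d_ker (ch_ses_exact (ses 0 k e)); split=> [[x <-]|[x <-]].
    by have [w <-] := (cbij n).2 x; exists w.
  by exists (c n x).
split=> [fd|[g gE] n x]; last first.
  rewrite -gE -[RHS](linear0 (g n)); congr (g n _); apply/d_ker.
  by apply/(ch_ses_exact (ses j k e')); exists (sval (p i j e) n x).
(* f vanishes on the image of Z_j in P_j, so it factors through Z_k; the factor extends to P_k
   because Hom(Z_(k-1), L) is exact. *)
have [n x|f' f'E] := ch_factor_surj (f := f) (ch_ses_surj (ses j k e')).
  move=> /(ch_ses_exact (ses j k e'))[y <-].
  by have [w <-] := ch_ses_surj (ses i j e) y; exact: fd.
have ek := int_pred k.
have [g gE] := chmap_extends (ses k _ ek) Ll f' ((svalP (Z (k - 1))).2 L Ll).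
by exists g => n x; rewrite /= gE f'E.
Qed.

(** Through [disk_in], a map to a level module becomes a chain map to a sum of disks on it, which is
    level; the factorisation is read off in the bottom component. *)
Lemma GACproj_cobj X n : ch_GACproj X -> mod_GACproj (X n).
Proof.
move=> [P [d [iota [Pp Pe ii Pl]]]].
exists (fun i => P i n), (fun i j e => d i j e n), (iota n); split=> //.
- by move=> i; exact: projective_cobj.
move=> L Ll i j k e e' f; split=> [fd|[g gE] x]; last first.
  rewrite -gE -[RHS](linear0 g); congr (g _).
  by apply/(Pe _ _ _ e e'); exists x.
have [s [sn s0]] := extend_family (V := P j) f.
have sd m x : s m (d i j e m x) = 0.
  by have [mn|/s0->//] := pselect (m = n); subst m; rewrite sn fd.
have [m x|G GE] := (Pl (disk (fun=> L)) (level_disk (fun=> Ll)) i j k e e'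
  (disk_in (M := fun=> L) s)).1.
  by apply: injective_projections; rewrite /= ?sd // -cmap_comm sd linear0.
exists (sndl L L \o G n) => x.
by have := congr1 snd (GE n x); rewrite /= sn.
Qed.

Lemma GACproj_null X L (f : chmap X L) :
  ch_GACproj X -> ch_level L -> null_homotopic f.
Proof.
move=> [P [d [iota [Pp Pe ii Pl]]]] Ll.
have e1 : 1 = 0 + 1 :> int by []; have e2 : 2 = 1 + 1 :> int by [].
have e0 : 0 = -1 + 1 :> int by [].
(* [r] is the differential P_1 -> P_0 corestricted to X. The composite f r is killed by the incoming
   differential, so it factors through P_0 as [g], and this g extends f. *)
have [n x|r rE] := ch_factor_inj (f := d 1 0 e1) (fun n => (ii n).1).
  by apply/((ii n).2 _ e0)/(Pe _ _ _ e1 e0); exists x.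
have [n x|g gE] := (Pl L Ll 2 1 0 e2 e1 (ch_comp f r)).1.
  suff h : r n (d 2 1 e2 n x) = 0 by rewrite /= h linear0.
  apply: (ii n).1; rewrite rE linear0; apply/(Pe _ _ _ e2 e1); by exists x.
have fE n x : f n x = ch_comp g iota n x.
  have /(Pe _ _ _ e1 e0)[y yE] := ((ii n).2 _ e0 (iota n x)).2 (ex_intro _ x erefl).
  by rewrite /= -yE gE /=; congr (f n _); apply: (ii n).1; rewrite rE.
have [s sE] := contractible_null g (projective_contractible (Pp 0)).
exists (fun i j e => s i j e \o iota i) => i j k e e' x.
by rewrite fE /= (sE _ _ _ e e') cmap_comm.
Qed.

End GorensteinComplexes.

Theorem theorem4p13 (R : pzRingType) (X : chcomplex R) :
  (ch_GACproj X <->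
     (forall n : int, mod_GACproj (X n))
     /\ (forall L : chcomplex R, ch_level L -> ab_exact (homC X L)))
  /\
  (ch_GACproj X <->
     (forall n : int, mod_GACproj (X n))
     /\ (forall L : chcomplex R, ch_level L ->
           forall f : chmap X L, null_homotopic f)).
Proof.
have null_exact : (forall L : chcomplex R, ch_level L ->
    forall f : chmap X L, null_homotopic f) ->
  forall L : chcomplex R, ch_level L -> ab_exact (homC X L).
  move=> XL L Ll; apply: homC_exact_shift => k f.
  by apply: XL; exact: level_shift.
have GX : ch_GACproj X -> forall n, mod_GACproj (X n) by move=> Xg n; exact: GACproj_cobj.
split; split=> [Xg|[Xn XL]].
- by split; [exact: GX | apply: null_exact => L Ll f; exact: GACproj_null].
- exact: dwGACproj_GACproj.
- by split=> [|L Ll f]; [exact: GX | exact: GACproj_null].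
- by apply: dwGACproj_GACproj; split=> //; exact: null_exact.
Qed.
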